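(* Let $T>0$ and let $F:[0,T]\times\mathbb{R}^n\rightrightarrows\mathbb{R}^n$ be a set-valued mapping satisfying the following four assumptions: (A1) for each $t\in[0,T]$, the operator $F(t,\cdot)$ is maximal monotone; (A2) there exists a nondecreasing absolutely continuous function $\varphi:[0,T]\to\mathbb{R}$ such that $\sup_{z\in\operatorname{dom}F(s,\cdot)}\operatorname{dist}\big(z,\operatorname{dom}F(t,\cdot)\big)\le\varphi(t)-\varphi(s)$ for all $s,t$ with $0\le s\le t\le T$; (A3) for every $r>0$ there exists $\sigma_r\in L_1([0,T],\mathbb{R}_+)$ such that $|F^0(t,x)|\le\sigma_r(t)(1+|x|)$ for all $t\in[0,T]$ and all $x\in\mathbb{B}^n(r)\cap\operatorname{dom}F(t,\cdot)$; (A4) the set-valued mapping $t\mapsto\operatorname{graph}F(t,\cdot)$ is outer semicontinuous on $[0,T]$. Then for every $x_0\in\operatorname{cl}\big(\operatorname{dom}F(0,\cdot)\big)$ there exists a unique solution $x\in AC([0,T],\mathbb{R}^n)$ of the differential inclusion $\dot x(t)\in-F(t,x(t))$, $x(0)=x_0$.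
   Context: $\operatorname{dom}G=\{x: G(x)\neq\emptyset\}$ and $\operatorname{graph}G=\{(x,y): y\in G(x)\}$ for a set-valued map $G$. $\mathbb{B}^n(r)=\{x\in\mathbb{R}^n:|x|\le r\}$, $|\cdot|$ the Euclidean norm, $\operatorname{dist}(x,S)=\inf_{y\in S}|x-y|$. For maximal monotone $F(t,\cdot)$, $F(t,x)$ is closed and convex for $x$ in its domain, and the minimal section is $F^0(t,x)=$ the projection of $0$ onto $F(t,x)$ (its least-norm element). Outer semicontinuity of $t\mapsto\operatorname{graph}F(t,\cdot)$ at $t^*$ means: whenever $t_\ell\to t^*$, $(x_\ell,y_\ell)\in\operatorname{graph}F(t_\ell,\cdot)$ and $(x_\ell,y_\ell)\to(x,y)$, then $(x,y)\in\operatorname{graph}F(t^*,\cdot)$; it holds on $[0,T]$ if it holds at every $t^*\in[0,T]$. A solution is a function $x\in AC([0,T],\mathbb{R}^n)$ with $x(0)=x_0$ such that $x(t)\in\operatorname{dom}F(t,\cdot)$ and $\dot x(t)\in-F(t,x(t))$ for almost all $t\in[0,T]$. *)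

(* Defs.v *)
From HB Require Import structures.
From mathcomp Require Import all_boot all_order all_algebra.
From mathcomp Require Import all_classical all_reals all_analysis.
Set Implicit Arguments. Unset Strict Implicit. Unset Printing Implicit Defensive.
Import Order.TTheory GRing.Theory Num.Theory.
Import numFieldNormedType.Exports.
Local Open Scope classical_set_scope.
Local Open Scope ring_scope.

Section Defs.
Variable R : realType.
Variable n : nat.
Local Notation vec := 'rV[R]_n.

Definition dotv (u v : vec) : R := \sum_(i < n) u ord0 i * v ord0 i.
Definition enorm (v : vec) : R := Num.sqrt (dotv v v).

Definition vdist (x : vec) (S : set vec) : R :=
  inf [set enorm (x - y) | y in S].

Definition sdom (G : vec -> set vec) : set vec := [set x | G x !=set0].
Definition sgraph (G : vec -> set vec) : set (vec * vec) :=
  [set p | G p.1 p.2].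

Definition monotone_op (G : vec -> set vec) : Prop :=
  forall x y u v, G x u -> G y v -> 0 <= dotv (u - v) (x - y).
Definition maximal_monotone (G : vec -> set vec) : Prop :=
  monotone_op G /\
  forall H : vec -> set vec, monotone_op H ->
    sgraph G `<=` sgraph H -> sgraph H = sgraph G.

(* minimal section: the least-norm element of G x (0 if there is none,
   which does not happen for x in dom G when G is maximal monotone) *)
Definition minsec (G : vec -> set vec) (x : vec) : vec :=
  xget 0 [set y | G x y /\ forall z, G x z -> enorm y <= enorm z].

Definition graph_osc_at (F : R -> vec -> set vec) (T tstar : R) : Prop :=
  forall (t_ : nat -> R) (x_ y_ : nat -> vec) (x y : vec),
    (forall l, 0 <= t_ l <= T) ->
    t_ @ \oo --> tstar ->
    (forall l, F (t_ l) (x_ l) (y_ l)) ->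
    x_ @ \oo --> x -> y_ @ \oo --> y ->
    F tstar x y.

End Defs.

Definition abs_cont (R : realType) (V : zmodType) (nrm : V -> R)
    (a b : R) (f : R -> V) : Prop :=
  forall eps : R, 0 < eps -> exists2 delta : R, 0 < delta &
    forall (k : nat) (c d : 'I_k -> R),
      (forall i, a <= c i /\ c i <= d i /\ d i <= b) ->
      (forall i j, i != j -> d i <= c j \/ d j <= c i) ->
      \sum_(i < k) (d i - c i) < delta ->
      \sum_(i < k) nrm (f (d i) - f (c i)) < eps.

Definition is_solution (R : realType) (n : nat) (F : R -> 'rV[R]_n -> set 'rV[R]_n)
    (T : R) (x0 : 'rV[R]_n) (x : R -> 'rV[R]_n) : Prop :=
  abs_cont (@enorm R n) 0 T x /\ x 0 = x0 /\
  {ae (@lebesgue_measure R), forall t, `[0, T]%classic t ->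
      sdom (F t) (x t) /\ derivable x t 1 /\ F t (x t) (- (derive1 x t))}.

(* Main.v *)
Require Import Defs.
From HB Require Import structures.
From mathcomp Require Import all_boot all_order all_algebra.
From mathcomp Require Import all_classical all_reals all_analysis.
From mathcomp Require Import measurable_realfun.
From mathcomp Require Import ring lra.
Import Order.TTheory GRing.Theory Num.Theory.
Import numFieldNormedType.Exports.
Local Open Scope classical_set_scope.
Local Open Scope ring_scope.

(* Implicit (catching-up) time stepping.  On the uniform grid of mesh l = T/N the
   scheme is x_{k+1} = (I + l F(t_k,.))^{-1} x_k, where the node t_k of the k-th cell
   is chosen so that l sigma(t_k) is at most twice the integral of sigma over the
   cell, up to l.  Together with (A2) this bounds the steps by the increments of
   one absolutely continuous function P, so a limit x along an ultrafilter exists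
   pointwise, is dominated by P, and is differentiable almost everywhere.

   The inclusion is proved pointwise, without weak compactness.  At a Lebesgue point
   t of P' and for (xi, eta) in the graph of F(t,.), maximality and outer
   semicontinuity give nearby points of the graphs of F(t_k,.) on every cell where
   sigma(t_k) is not too large.  The other cells carry a mass o(h) of P on
   [t, t + h], so summing the monotonicity inequalities over the cells in
   [t, t + h] and letting N tend to infinity and then h to 0 gives
   <x'(t) + eta, x(t) - xi> <= 0, and -x'(t) is in F(t, x(t)) by maximality.

   Uniqueness is monotonicity: |x - y|^2 is absolutely continuous with nonpositive
   derivative almost everywhere. *)

(** * Euclidean vectors *)

(** Two obstacles shape the scheme. The function [sigma] is merely integrable, so its value at a
    prescribed grid point says nothing; hence the averaging choice of nodes in [common_node].
    Moreover [sigma] depends on the radius of a ball, while a bound on the iterates seems to require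
    [sigma] beforehand. The circle is broken by a comparison sequence that only follows the moving
    domains: (A2) alone bounds it, by a radius [R0]. Nonexpansiveness of the resolvents and [sigma]
    at radius [R0] bound the iterates by [R1], and [sigma] at radius [R1] bounds the individual
    steps. Nodes must therefore be good for both functions at once. Since a node may lie anywhere in
    its cell, consecutive nodes can span two cells, which is the source of the pairs of masses and
    of the factor 2 in [limit_increment]. Dominating everything by the primitive of one density [g],
    obtained by Radon-Nikodym, provides Lebesgue points; these replace the uniform velocity bounds
    that an integrable [sigma] cannot give. *)

Section Euclidean.
Context {R : realType} {n : nat}.
Implicit Types u v w : 'rV[R]_n.

Lemma dotvC u v : dotv u v = dotv v u.
Proof. by apply: eq_bigr => i _; rewrite mulrC. Qed.

Lemma dotvDl u v w : dotv (u + v) w = dotv u w + dotv v w.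
Proof. by rewrite /dotv -big_split; apply: eq_bigr => i _; rewrite mxE mulrDl. Qed.

Lemma dotvNl u v : dotv (- u) v = - dotv u v.
Proof. by rewrite /dotv -sumrN; apply: eq_bigr => i _; rewrite mxE mulNr. Qed.

Lemma dotvZl a u v : dotv (a *: u) v = a * dotv u v.
Proof. by rewrite /dotv mulr_sumr; apply: eq_bigr => i _; rewrite mxE mulrA. Qed.

Lemma dotvDr u v w : dotv u (v + w) = dotv u v + dotv u w.
Proof. by rewrite dotvC dotvDl !(dotvC u). Qed.

Lemma dotvNr u v : dotv u (- v) = - dotv u v.
Proof. by rewrite dotvC dotvNl dotvC. Qed.

Lemma dotvZr a u v : dotv u (a *: v) = a * dotv u v.
Proof. by rewrite dotvC dotvZl dotvC. Qed.

Lemma dot0v u : dotv 0 u = 0.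
Proof. by rewrite -(subrr 0) dotvDl dotvNl subrr. Qed.

Lemma dotv0 u : dotv u 0 = 0.
Proof. by rewrite dotvC dot0v. Qed.

Definition dotvE := (dotvDl, dotvDr, dotvNl, dotvNr, dotvZl, dotvZr).

Lemma dotv_ge0 u : 0 <= dotv u u.
Proof. by apply: sumr_ge0 => i _; rewrite -expr2 sqr_ge0. Qed.

Lemma enorm_ge0 u : 0 <= enorm u.
Proof. exact: sqrtr_ge0. Qed.

Lemma enorm_sqr u : enorm u ^+ 2 = dotv u u.
Proof. by rewrite sqr_sqrtr// dotv_ge0. Qed.

Lemma enorm0 : enorm (0 : 'rV[R]_n) = 0.
Proof. by rewrite /enorm dot0v sqrtr0. Qed.

Lemma enormN u : enorm (- u) = enorm u.
Proof. by rewrite /enorm !dotvE opprK. Qed.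

Lemma enormB u v : enorm (u - v) = enorm (v - u).
Proof. by rewrite -enormN opprB. Qed.

Lemma enormZ a u : enorm (a *: u) = `|a| * enorm u.
Proof. by rewrite /enorm !dotvE mulrA -expr2 sqrtrM ?sqr_ge0// sqrtr_sqr. Qed.

Lemma enorm_le u c : 0 <= c -> dotv u u <= c ^+ 2 -> enorm u <= c.
Proof. by move=> c0 uc; rewrite -ler_sqr ?nnegrE ?enorm_ge0// enorm_sqr. Qed.

Lemma coord_le_enorm u i : `|u ord0 i| <= enorm u.
Proof.
rewrite -ler_sqr ?nnegrE ?enorm_ge0// enorm_sqr real_normK ?num_real//.
rewrite /dotv (bigD1 i)//= expr2 lerDl.
by apply: sumr_ge0 => j _; rewrite -expr2 sqr_ge0.
Qed.

Lemma enorm_eq0 u : enorm u = 0 -> u = 0.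
Proof.
move=> u0; apply/rowP => i; rewrite mxE; apply/eqP.
by rewrite -normr_le0 -u0 coord_le_enorm.
Qed.

Lemma cauchy_schwarz u v : dotv u v <= enorm u * enorm v.
Proof.
have := dotv_ge0 (enorm v *: u - enorm u *: v).
rewrite !dotvE -!enorm_sqr (dotvC v u).
have := enorm_ge0 u; have := enorm_ge0 v.
have [->|u0] := eqVneq u 0; first by move=> *; rewrite dot0v enorm0 mul0r.
have [->|v0] := eqVneq v 0; first by move=> *; rewrite dotv0 enorm0 mulr0.
have up : 0 < enorm u by rewrite lt_def enorm_ge0 andbT; apply: contraNneq u0 => /enorm_eq0 ->.
have vp : 0 < enorm v by rewrite lt_def enorm_ge0 andbT; apply: contraNneq v0 => /enorm_eq0 ->.
move=> _ _ h; have uv := mulr_gt0 up vp.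
by rewrite -(ler_pM2l uv); lra.
Qed.

Lemma cauchy_schwarz_norm u v : `|dotv u v| <= enorm u * enorm v.
Proof.
rewrite ler_norml cauchy_schwarz andbT lerNl -dotvNl.
by rewrite -(enormN u) cauchy_schwarz.
Qed.

Lemma enormD u v : enorm (u + v) <= enorm u + enorm v.
Proof.
rewrite -ler_sqr ?nnegrE ?addr_ge0 ?enorm_ge0// enorm_sqr !dotvE sqrrD !enorm_sqr.
by have := cauchy_schwarz u v; rewrite (dotvC v u); lra.
Qed.

Lemma enorm_distD w u v : enorm (u - v) <= enorm (u - w) + enorm (w - v).
Proof. by rewrite -{1}(subrK w u) -addrA enormD. Qed.

Lemma enorm_subD u v : enorm u <= enorm (u - v) + enorm v.
Proof. by rewrite -{1}(subrK v u) enormD. Qed.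

Lemma enorm_le_norm u : enorm u <= n%:R * `|u|.
Proof.
have ui i : `|u ord0 i| <= `|u|.
  rewrite [leRHS]mx_normrE; apply: (le_bigmax _ (fun ij => `|u ij.1 ij.2|) (ord0, i)).
rewrite -ler_sqr ?nnegrE ?enorm_ge0 ?mulr_ge0// enorm_sqr.
have [n0|n0] := posnP n.
  rewrite /dotv big1 ?sqr_ge0// => -[i i_n]; exfalso.
  by move: i_n; rewrite n0.
apply: (@le_trans _ _ (\sum_(i < n) `|u| ^+ 2)).
  apply: ler_sum => i _; rewrite -expr2 -real_normK ?num_real//.
  by rewrite ler_sqr ?nnegrE.
rewrite sumr_const card_ord -[leLHS]mulr_natl exprMn.
by rewrite ler_wpM2r ?sqr_ge0// -natrX ler_nat expnS leq_pmulr// expn1.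
Qed.

Lemma norm_le_enorm u : `|u| <= enorm u.
Proof.
rewrite [leLHS]mx_normrE; apply/bigmax_leP; split; first exact: enorm_ge0.
by move=> [i j] _ /=; rewrite (ord1 i) coord_le_enorm.
Qed.

End Euclidean.

Section EuclideanTopology.
Context {R : realType} {n : nat}.

Lemma closure_enorm (S : set 'rV[R]_n) x :
  closure S x <-> forall e, 0 < e -> exists2 y, S y & enorm (x - y) < e.
Proof.
split=> [Sx e e0|Sx].
  have e1 : 0 < e / n.+1%:R by rewrite divr_gt0.
  have [y [Sy /= xy]] := Sx _ (nbhsx_ballx x (PosNum e1)%:num e1).
  exists y => //; apply: (le_lt_trans (enorm_le_norm _)).
  move: xy; rewrite -ball_normE/= ltr_pdivlMr// => xy.
  apply: le_lt_trans xy; rewrite mulrC ler_wpM2l// ler_nat leqnSn//.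
move=> B /nbhs_ballP[e e0 eB]; have [y Sy xy] := Sx _ e0.
exists y; split=> //; apply: eB; rewrite -ball_normE/=.
exact: le_lt_trans (norm_le_enorm _) xy.
Qed.

Lemma cvg_enorm (I : Type) (F : set_system I) {FF : Filter F} (x_ : I -> 'rV[R]_n) (x : 'rV[R]_n) :
  x_ @ F --> x <-> forall e, 0 < e -> \forall i \near F, enorm (x_ i - x) < e.
Proof.
split=> [/cvgrPdist_lt xx e e0|xx].
  have e1 : 0 < e / n.+1%:R by rewrite divr_gt0.
  near=> i; rewrite enormB; apply: (le_lt_trans (enorm_le_norm _)).
  have : `|x - x_ i| < e / n.+1%:R by near: i; exact: xx.
  rewrite ltr_pdivlMr//; apply: le_lt_trans.
  by rewrite mulrC ler_wpM2l// ler_nat leqnSn.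
apply/cvgrPdist_lt => e e0; near=> i.
rewrite distrC; apply: (le_lt_trans (norm_le_enorm _)).
by near: i; exact: xx.
Unshelve. all: by end_near. Qed.

Lemma derivable_enorm (x : R -> 'rV[R]_n) (t e : R) : derivable x t 1 -> 0 < e ->
  exists2 d : R, 0 < d & forall h, `|h| < d ->
    enorm (x (t + h) - x t - h *: derive1 x t) <= e * `|h|.
Proof.
move=> dx e0; set v := derive1 x t.
have dxv : (fun h => h^-1 *: ((x \o shift t) (h *: 1) - x t)) @ 0^' --> v.
  by rewrite /v derive1E; exact: dx.
have [d /= d0 dP] := (cvg_enorm _ _ _ _).1 dxv _ e0.
exists d => // h hd; have [->|hn0] := eqVneq h 0.
  by rewrite addr0 subrr scale0r subr0 enorm0 normr0 mulr0.
have := dP h; rewrite /= sub0r normrN => /(_ hd hn0) /ltW.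
have -> : x (t + h) - x t - h *: v = h *: (h^-1 *: (x (h%:A + t) - x t) - v).
  by rewrite scalerBr scalerA mulfV// scale1r [h%:A]mulr1 (addrC h).
by rewrite enormZ mulrC => ?; rewrite ler_wpM2r.
Qed.

Lemma enorm_ball_compact (M : R) : compact [set x : 'rV[R]_n | enorm x <= M].
Proof.
apply: bounded_closed_compact.
  exists M; split; first exact: num_real.
  move=> K MK x /= xM; apply: le_trans (norm_le_enorm _) (le_trans xM (ltW MK)).
move=> x /closure_enorm cx /=; apply/ler_addgt0Pr => e e0.
have [y /= yM xy] := cx _ e0.
by have := enorm_subD x y; lra.
Qed.

End EuclideanTopology.

(** * Maximal monotone operators *)

Lemma le_of_small {R : realType} (a b K : R) :
  (forall e : R, 0 < e <= 1 -> a <= b + e * K) -> a <= b.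
Proof.
move=> h; apply/ler_addgt0Pr => e e0.
have K0 : 0 < `|K| + 1 by rewrite ltr_wpDl.
pose d := Num.min 1 (e / (`|K| + 1)).
have d0 : 0 < d by rewrite lt_min ltr01 divr_gt0.
have d1 : d <= 1 by rewrite ge_min lexx.
have := h d; rewrite d0 d1 => /(_ isT)/le_trans; apply.
rewrite lerD2l; apply: (@le_trans _ _ (d * (`|K| + 1))).
  rewrite ler_pM2l//; apply: le_trans (ler_norm _) _; by rewrite lerDl.
by rewrite -ler_pdivlMr// ge_min lexx orbT.
Qed.

(** * Minimizing a quadratic over a convex set *)

Section ConvexMinimization.
Context {R : realType} {n : nat}.
Local Notation vec := 'rV[R]_n.

Lemma bounded_cluster (x_ : nat -> vec) (M : R) : (forall k, enorm (x_ k) <= M) ->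
  exists p : vec, forall (e : R) N, 0 < e -> exists2 k, (N <= k)%N & enorm (x_ k - p) < e.
Proof.
move=> xM.
have [|p [_ px]] := @enorm_ball_compact R n M (x_ @ \oo) (fmap_proper_filter _ _).
  by exists 0%N => // k _; exact: xM.
exists p => e N e0.
have [||y [[k Nk <-] ky]] := px (x_ @` [set k | (N <= k)%N]) (ball p (e / n.+1%:R)).
- by exists N => // k /= Nk; exists k.
- by apply: nbhsx_ballx; rewrite divr_gt0.
exists k => //; rewrite enormB; apply: (le_lt_trans (enorm_le_norm _)).
move: ky; rewrite -ball_normE/= ltr_pdivlMr//; apply: le_lt_trans.
by rewrite mulrC ler_wpM2l// ler_nat leqnSn.
Qed.

(** [K] is not assumed closed, so the infimum [D] need not be attained: [c0] is a cluster point of a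
    minimizing sequence, and the last clause is the first-order condition there. The linear variable
    [s] carries the duality product in [monotone_op_extension] and vanishes in [minsec_in]. *)
Lemma convex_min (K : vec -> R -> Prop) :
  (forall (e : R) c s c' s', 0 <= e <= 1 -> K c s -> K c' s' ->
     K ((1 - e) *: c + e *: c') ((1 - e) * s + e * s')) ->
  (exists c s, K c s) ->
  (exists m : R, forall c s, K c s -> m <= dotv c c + s) ->
  exists (c0 : vec) (D : R), [/\ forall e : R, 0 < e ->
      exists c s, [/\ K c s, enorm (c - c0) < e & dotv c c + s < D + e],
    forall c s, K c s -> D <= dotv c c + s &
    forall c s, K c s -> D <= 2 * dotv c0 c - dotv c0 c0 + s].
Proof.
move=> convK [c1 [s1 K1]] [m mK].
pose E := [set r | exists c s, K c s /\ r = dotv c c + s].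
have infE : has_inf E.
  split; first by exists (dotv c1 c1 + s1), c1, s1.
  by exists m => _ [c [s [Kcs ->]]]; exact: mK.
pose D := inf E.
have DK c s : K c s -> D <= dotv c c + s.
  by move=> Kcs; apply: inf_lbound; [case: infE|exists c, s].
have near_inf k : exists cs : vec * R, K cs.1 cs.2 /\ dotv cs.1 cs.1 + cs.2 < D + k.+1%:R^-1.
  have [|_ [c [s [Kcs ->]]] h] := @inf_adherent _ E k.+1%:R^-1 _ infE.
    by rewrite invr_gt0.
  by exists (c, s).
have [cs csP] := choice near_inf.
(* Parallelogram identity: both values are below [D + 1] and the midpoint has value at least [D], so
   the squared distance is at most 4. *)
have bnd k : enorm (cs k).1 <= 2 + enorm (cs 0%N).1.
  apply: le_trans (enorm_subD _ (cs 0%N).1) _; rewrite lerD2r.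
  have [Kk hk] := csP k; have [K0 h0] := csP 0%N.
  have half : 0 <= (2^-1 : R) <= 1 by lra.
  have := DK _ _ (convK _ _ _ _ _ half Kk K0).
  move=> h; apply: enorm_le => //; move: h; rewrite !dotvE (dotvC (cs 0%N).1).
  have k1 : k.+1%:R^-1 <= 1 :> R by rewrite invf_le1// ler1n.
  have {}hk : dotv (cs k).1 (cs k).1 + (cs k).2 < D + 1.
    by apply: lt_le_trans hk _; rewrite lerD2l.
  have {}h0 : dotv (cs 0%N).1 (cs 0%N).1 + (cs 0%N).2 < D + 1.
    by apply: lt_le_trans h0 _; rewrite invr1.
  lra.
have [c0 c0P] := bounded_cluster _ _ bnd.
have nearc e : 0 < e ->
    exists c s, [/\ K c s, enorm (c - c0) < e & dotv c c + s < D + e].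
  move=> e0.
  have [k ke ce] := c0P e (Num.truncn e^-1) e0.
  have [Kk hk] := csP k; exists (cs k).1, (cs k).2; split => //.
  apply: lt_trans hk _; rewrite ltrD2l -[ltRHS]invrK ltf_pV2 ?posrE ?invr_gt0//.
  apply: lt_le_trans (truncnS_gt _) _; by rewrite ler_nat ltnS.
exists c0, D; split => // c' s' K'.
pose C := 2 * enorm c' + 2 * enorm c0 + (enorm (c' - c0) + 1) ^+ 2 + 1.
apply: (@le_of_small _ _ _ C) => e /andP[e0 e1].
(* Accuracy [e ^+ 2], because the comparison along the segment from [c] towards [c'] is divided by
   [e] and must still leave an error of order [e]. *)
have [|c [s [Kcs ce fe]]] := nearc (e ^+ 2); first by rewrite exprn_gt0.
have e01 : 0 <= e <= 1 by rewrite (ltW e0) e1.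
have := DK _ _ (convK _ _ _ _ _ e01 Kcs K').
have Dcs := DK _ _ Kcs.
have h1 : dotv c c' <= dotv c0 c' + e * enorm c'.
  rewrite -[X in dotv X c' <= _](subrK c0) dotvDl addrC lerD2l.
  apply: le_trans (cauchy_schwarz _ _) _; rewrite ler_wpM2r ?enorm_ge0//.
  apply: le_trans (ltW ce) _; rewrite expr2; nra.
have h2 : dotv c0 c0 <= dotv c c + 2 * e * enorm c0.
  have := dotv_ge0 (c - c0); rewrite !dotvE.
  have := cauchy_schwarz c0 (c0 - c); rewrite !dotvE (dotvC c c0).
  have : enorm c0 * enorm (c0 - c) <= enorm c0 * e.
    rewrite ler_wpM2l ?enorm_ge0// enormB; apply: le_trans (ltW ce) _.
    rewrite expr2; nra.
  lra.
have h3 : dotv (c' - c) (c' - c) <= (enorm (c' - c0) + 1) ^+ 2.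
  rewrite -enorm_sqr ler_sqr ?nnegrE ?addr_ge0 ?enorm_ge0//.
  apply: le_trans (enorm_distD c0 _ _) _; rewrite lerD2l enormB.
  apply: le_trans (ltW ce) _; rewrite expr2; nra.
have -> : dotv ((1 - e) *: c + e *: c') ((1 - e) *: c + e *: c') =
   dotv c c + 2 * e * (dotv c c' - dotv c c) + e ^+ 2 * dotv (c' - c) (c' - c).
  by rewrite !dotvE (dotvC c' c); ring.
move: h3; set q := dotv (c' - c) _; set Q := (_ + 1) ^+ 2 => h3 h.
have h4 : 0 <= e * (2 * dotv c c' - dotv c c + s' - D + e * (q + 1)).
  move: h fe Dcs; rewrite expr2 => h fe Dcs.
  have : e * (D - dotv c c) <= e * s by rewrite ler_pM2l// lerBlDl.
  lra.
have {h4} : 0 <= 2 * dotv c c' - dotv c c + s' - D + e * (q + 1) by rewrite -(pmulr_rge0 _ e0).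
have : e * q <= e * Q by rewrite ler_pM2l.
rewrite /C -/Q; lra.
Qed.

End ConvexMinimization.

(** * Minty's theorem, resolvents and the minimal section *)

Section Minty.
Context {R : realType} {n : nat}.
Local Notation vec := 'rV[R]_n.
Implicit Type A : vec -> set vec.

(** Convex hull of the graph lifted by the duality product, generated by binary combinations so that
    inequalities pass to it by induction. The lower envelope in [s] is the convex function whose
    conjugate, with arguments swapped, is the Fitzpatrick function of [A]. *)
Inductive graph_hull A : vec -> vec -> R -> Prop :=
| GraphHullIn a b : A a b -> graph_hull A a b (dotv a b)
| GraphHullConv e a b s a' b' s' : 0 <= e <= 1 ->
    graph_hull A a b s -> graph_hull A a' b' s' ->
    graph_hull A ((1 - e) *: a + e *: a') ((1 - e) *: b + e *: b')
      ((1 - e) * s + e * s').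

Lemma graph_hull_in_le A a b a' b' s' : monotone_op A -> A a b ->
  graph_hull A a' b' s' -> dotv a b' + dotv a' b <= dotv a b + s'.
Proof.
move=> mA Aab; elim=> {a' b' s'} [a' b' A'|e a1 b1 s1 a2 b2 s2 e01 _ IH1 _ IH2].
  have := mA _ _ _ _ Aab A'; rewrite !dotvE (dotvC b a) (dotvC b a') (dotvC b' a) (dotvC b' a').
  lra.
rewrite !dotvE; have /andP[e0 e1] := e01.
have : 0 <= (1 - e) * (dotv a b + s1 - (dotv a b1 + dotv a1 b)).
  by apply: mulr_ge0; lra.
have : 0 <= e * (dotv a b + s2 - (dotv a b2 + dotv a2 b)).
  by apply: mulr_ge0; lra.
lra.
Qed.

(** The claim is not inductive, but its polarized form for two hull points is: it is affine in each
    triple and is monotonicity on the graph. The diagonal gives the claim. *)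
Lemma graph_hull_le A a b s : monotone_op A -> graph_hull A a b s -> dotv a b <= s.
Proof.
move=> mA; have hh a' b' s' : graph_hull A a b s -> graph_hull A a' b' s' ->
    dotv a b' + dotv a' b <= s + s'.
  move=> + h'; elim=> {a b s} [a b Aab|e a1 b1 s1 a2 b2 s2 e01 _ IH1 _ IH2].
    exact: graph_hull_in_le h'.
  rewrite !dotvE; have /andP[e0 e1] := e01.
  have : 0 <= (1 - e) * (s1 + s' - (dotv a1 b' + dotv a' b1)).
    by apply: mulr_ge0; lra.
  have : 0 <= e * (s2 + s' - (dotv a2 b' + dotv a' b2)).
    by apply: mulr_ge0; lra.
  lra.
by move=> h; have := hh _ _ _ h h; lra.
Qed.

(* Minimize |c|^2 + s over the points c = (a - b)/2 with (a, b, s) in the hull of the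
   points (a, b, <a, b>) of the graph: the minimum is nonnegative by [graph_hull_le],
   and the first-order conditions at the minimizer x are the claimed inequalities. *)
Lemma monotone_op_extension A : monotone_op A ->
  exists x, forall a b, A a b -> 0 <= dotv (a - x) (b + x).
Proof.
move=> mA.
have [[a1 [b1 A1]]|A0] := pselect (exists a b, A a b); last first.
  by exists 0 => a b Aab; exfalso; apply: A0; exists a, b.
pose K c s := exists a b, graph_hull A a b s /\ c = 2^-1 *: (a - b).
(* |(a - b)/2|^2 + <a, b> = |(a + b)/2|^2. *)
have K_ge0 c s : K c s -> 0 <= dotv c c + s.
  move=> [a [b [h ->]]]; have := graph_hull_le _ _ _ _ mA h.
  have := dotv_ge0 (2^-1 *: (a + b)); rewrite !dotvE (dotvC b a); lra.
have [|||x [D [xD _ Dx]]] := convex_min K.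
- move=> e c s c' s' e01 [a [b [h ->]]] [a' [b' [h' ->]]].
  exists ((1 - e) *: a + e *: a'), ((1 - e) *: b + e *: b'); split.
    exact: GraphHullConv.
  rewrite !scalerA; apply/rowP => i; rewrite !mxE; lra.
- by exists (2^-1 *: (a1 - b1)), (dotv a1 b1), a1, b1; split => //; exact: GraphHullIn.
- by exists 0.
have D0 : 0 <= D.
  apply/ler_addgt0Pr => e /xD[c [s [/K_ge0 Kcs _]]]; lra.
exists x => a b Aab.
(* The inequality factors: <x, a - b> - |x|^2 + <a, b> = <a - x, b + x>. *)
have := Dx (2^-1 *: (a - b)) (dotv a b).
have Kab : K (2^-1 *: (a - b)) (dotv a b).
  by exists a, b; split => //; exact: GraphHullIn.
move=> /(_ Kab); rewrite !dotvE (dotvC a x); lra.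
Qed.

Lemma maximal_monotone_in A (x u : vec) : maximal_monotone A ->
  (forall a b, A a b -> 0 <= dotv (u - b) (x - a)) -> A x u.
Proof.
move=> [mA maxA] xu.
pose H y := [set v | A y v \/ (y = x /\ v = u)].
have mH : monotone_op H.
  move=> y y' v v' [Ay|[-> ->]] [Ay'|[-> ->]]; [exact: mA| | exact: xu |].
  - by have := xu _ _ Ay; rewrite !dotvE; lra.
  - by rewrite !subrr dot0v.
have AH : sgraph A `<=` sgraph H by move=> [y v] Ay; left.
have : sgraph H (x, u) by right.
by rewrite (maxA H mH AH).
Qed.

Lemma maximal_monotone_nonempty A : maximal_monotone A -> exists a b, A a b.
Proof.
move=> mA; have [//|A0] := pselect (exists a b, A a b); exists 0, 0.
by apply: maximal_monotone_in => // a b Aab; exfalso; apply: A0; exists a, b.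
Qed.

(** Surjectivity of [I + l A]. For [B = l A(. + z)] the extension lemma gives a point (x, -x)
    monotonically related to the graph of [B]; undoing the change of variables, maximality puts (x +
    z, -x/l) in the graph of [A]. *)
Lemma minty A (l : R) (z : vec) : maximal_monotone A -> 0 < l ->
  exists x, A x (l^-1 *: (z - x)).
Proof.
move=> MA l0; have [mA _] := MA; have lV0 : 0 < l^-1 by rewrite invr_gt0.
pose B a := [set b | A (a + z) (l^-1 *: b)].
have mB : monotone_op B.
  move=> x y u v /= Bx By; have := mA _ _ _ _ Bx By.
  rewrite -scalerBr opprD addrACA subrr addr0 dotvZl pmulr_rge0//.
have [x xB] := monotone_op_extension _ mB.
exists (x + z); apply: maximal_monotone_in => // a b Aab.
have := xB (a - z) (l *: b); rewrite /B/= subrK scalerA mulVf ?gt_eqF// scale1r.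
move=> /(_ Aab); rewrite -(pmulr_rge0 _ lV0).
have -> : l^-1 *: (z - (x + z)) - b = - l^-1 *: (l *: b + x).
  by apply/rowP => i; rewrite !mxE; field; rewrite gt_eqF.
have -> : x + z - a = - (a - z - x).
  by apply/rowP => i; rewrite !mxE; ring.
by rewrite scaleNr dotvNl dotvNr opprK dotvZl (dotvC (_ + _)).
Qed.

Lemma resolvent_dist A (l : R) (z z' x x' : vec) : monotone_op A -> 0 < l ->
  A x (l^-1 *: (z - x)) -> A x' (l^-1 *: (z' - x')) -> enorm (x - x') <= enorm (z - z').
Proof.
move=> mA l0 Ax Ax'; have := mA _ _ _ _ Ax Ax'.
rewrite -scalerBr dotvZl pmulr_rge0 ?invr_gt0// => h.
have [->|xx'] := eqVneq x x'; first by rewrite subrr enorm0 enorm_ge0.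
have p : 0 < enorm (x - x').
  rewrite lt_def enorm_ge0 andbT; apply: contraNneq xx' => /enorm_eq0/eqP.
  by rewrite subr_eq0.
rewrite -(ler_pM2r p) -expr2 enorm_sqr.
apply: le_trans (cauchy_schwarz _ _); move: h.
have -> : z - x - (z' - x') = (z - z') - (x - x').
  by apply/rowP => i; rewrite !mxE; ring.
by rewrite dotvDl dotvNl subr_ge0.
Qed.

(** [p] is itself the resolvent of [p + l *: u], so nonexpansiveness applies. *)
Lemma resolvent_step A (l : R) (p x u : vec) : monotone_op A -> 0 < l ->
  A x (l^-1 *: (p - x)) -> A p u -> enorm (x - p) <= l * enorm u.
Proof.
move=> mA l0 Ax Ap.
have Ap' : A p (l^-1 *: (p + l *: u - p)).
  by rewrite addrAC subrr add0r scalerA mulVf ?gt_eqF// scale1r.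
apply: le_trans (resolvent_dist _ _ _ _ _ _ mA l0 Ax Ap') _.
by rewrite opprD addrA subrr add0r enormN enormZ gtr0_norm.
Qed.

(** The default of [xget] does not occur: by maximality [A x] is convex and closed, so vectors of
    nearly minimal norm cluster at an element of [A x] of least norm. *)
Lemma minsec_in A (x : vec) : maximal_monotone A -> sdom A x -> A x (minsec A x).
Proof.
move=> MA [u0 Au0]; have [mA _] := MA.
pose K c (s : R) := A x c /\ s = 0.
have [|||c [D [cD DK _]]] := convex_min K.
- move=> e c s c' s' /andP[e0 e1] [Ac ->] [Ac' ->]; split; last by rewrite !mulr0 addr0.
  apply: maximal_monotone_in => // a b Aab.
  have h1 := mA _ _ _ _ Ac Aab; have h2 := mA _ _ _ _ Ac' Aab.
  have -> : (1 - e) *: c + e *: c' - b = (1 - e) *: (c - b) + e *: (c' - b).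
    by apply/rowP => i; rewrite !mxE; ring.
  by rewrite dotvDl !dotvZl addr_ge0// mulr_ge0// subr_ge0.
- by exists u0, 0.
- by exists 0 => v s [_ ->]; rewrite addr0 dotv_ge0.
have Ac : A x c.
  apply: maximal_monotone_in => // a b Aab.
  apply: (@le_of_small _ _ _ (enorm (x - a))) => e /andP[e0 _].
  have [v [s [[Av _] vc _]]] := cD _ e0.
  have := mA _ _ _ _ Av Aab.
  have -> : v - b = (v - c) + (c - b) by rewrite addrA subrK.
  rewrite dotvDl => /le_trans; apply; rewrite addrC lerD2l.
  apply: le_trans (cauchy_schwarz _ _) _.
  by rewrite ler_wpM2r ?enorm_ge0// ltW.
suff : [set y | A x y /\ forall z, A x z -> enorm y <= enorm z] (minsec A x) by case.
rewrite /minsec; case: xgetP => [y -> //|/(_ c)[]]; split=> // z Az.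
apply: enorm_le; first exact: enorm_ge0.
rewrite enorm_sqr; have := DK z 0 (conj Az erefl); rewrite addr0; apply: le_trans.
pose C := 2 * enorm c + 1.
apply: (@le_of_small _ _ _ C) => e /andP[e0 e1].
have [v [s [[Av ->] vc]]] := cD _ e0; rewrite addr0 => vD.
have := cauchy_schwarz c (c - v); have := dotv_ge0 (c - v).
have : enorm c * enorm (c - v) <= enorm c * e.
  by rewrite ler_wpM2l ?enorm_ge0// enormB ltW.
rewrite !dotvE (dotvC v c) /C; lra.
Qed.

End Minty.

Section GraphContinuity.
Context {R : realType} {n : nat}.
Local Notation vec := 'rV[R]_n.

(* Outer semicontinuity alone controls limits of graph points; maximality
   turns it into inner semicontinuity as long as the resolvents stay bounded. *)
Lemma graph_inner_semicontinuous (F : R -> vec -> set vec) (T t M : R) (xi eta : vec) :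
  (forall s : R, 0 <= s <= T -> maximal_monotone (F s)) -> 0 <= t <= T ->
  graph_osc_at F T t -> F t xi eta ->
  forall e : R, 0 < e -> exists2 d : R, 0 < d & forall s : R, 0 <= s <= T -> `|s - t| < d ->
    forall p u, F s p u -> enorm p <= M -> enorm u <= M ->
    exists xi' eta', [/\ F s xi' eta', enorm (xi' - xi) < e & enorm (eta' - eta) < e].
Proof.
move=> MF tT osc Fxi e e0; apply: contrapT => nd.
(* The candidate is the resolvent point with [x + y = xi + eta], whose only value at time [t] is
   [(xi, eta)]. As the sum is fixed, the errors in [x] and [y] are opposite and one estimate serves
   for both. Nonexpansiveness, compared with [(p, u)], bounds these points. *)
have bad k : exists sxy : R * vec * vec, [/\ 0 <= sxy.1.1 <= T,
    `|sxy.1.1 - t| < k.+1%:R^-1, F sxy.1.1 sxy.1.2 sxy.2,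
    sxy.1.2 + sxy.2 = xi + eta & enorm sxy.1.2 <= 2 * M + enorm (xi + eta) + M /\
    e <= enorm (sxy.1.2 - xi)].
  apply: contrapT => nk; apply: nd; exists k.+1%:R^-1; first by rewrite invr_gt0.
  move=> s sT st p u Fpu pM uM; have [mF _] := MF s sT.
  have [x Fx] := minty _ 1 (xi + eta) (MF s sT) ltr01.
  have Fp : F s p (1^-1 *: (p + u - p)) by rewrite invr1 scale1r addrAC subrr add0r.
  have xp := resolvent_dist _ _ _ _ _ _ mF ltr01 Fx Fp.
  exists x, (xi + eta - x).
  have ee : enorm (xi + eta - x - eta) = enorm (x - xi).
    by rewrite enormB; congr enorm; apply/rowP => i; rewrite !mxE; ring.
  rewrite ee; rewrite invr1 scale1r in Fx.
  suff : enorm (x - xi) < e by [].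
  rewrite ltNge; apply/negP => ex; apply: nk; exists (s, x, xi + eta - x); split => //=.
    by rewrite addrC subrK.
  split=> //; have := enorm_subD x p; have := enormD (xi + eta) (- (p + u)).
  by rewrite enormN; have := enormD p u; lra.
have [sxy sxyP] := choice bad.
have [|x0 x0P] := bounded_cluster (fun k => (sxy k).1.2) (2 * M + enorm (xi + eta) + M).
  by move=> k; have [_ _ _ _ []] := sxyP k.
have /choice[k kP] : forall l, exists k, (l <= k)%N /\
    enorm ((sxy k).1.2 - x0) < l.+1%:R^-1.
  move=> l; have [|k lk kx] := x0P l.+1%:R^-1 l; first by rewrite invr_gt0.
  by exists k.
have small l : forall e' : R, 0 < e' -> (Num.truncn e'^-1 <= l)%N -> l.+1%:R^-1 < e' :> R.
  move=> e' e'0 le'; rewrite -[ltRHS]invrK ltf_pV2 ?posrE ?invr_gt0//.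
  by apply: lt_le_trans (truncnS_gt _) _; rewrite ler_nat ltnS.
have xcvg : (fun l => (sxy (k l)).1.2) @ \oo --> x0.
  apply/cvg_enorm => e' e'0; exists (Num.truncn e'^-1) => // l /= le'.
  by have [_ /lt_trans] := kP l; apply; exact: small.
have Fx0 : F t x0 (xi + eta - x0).
  apply: (osc (fun l => (sxy (k l)).1.1) (fun l => (sxy (k l)).1.2)
              (fun l => (sxy (k l)).2)) => //.
  - by move=> l; have [] := sxyP (k l).
  - apply/cvgrPdist_lt => e' e'0; exists (Num.truncn e'^-1) => // l /= le'.
    rewrite distrC; have [_ + _ _ _] := sxyP (k l); move/lt_trans; apply.
    by apply: small => //; have [lk _] := kP l; exact: leq_trans lk.
  - by move=> l; have [] := sxyP (k l).
  - have -> : (fun l => (sxy (k l)).2) = (fun l => xi + eta - (sxy (k l)).1.2).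
      by apply/funext => l; have [_ _ _ <- _] := sxyP (k l); rewrite addrAC subrr add0r.
    by apply: cvgB => //; exact: cvg_cst.
(* Monotonicity at time [t] reads -|x0 - xi|^2 >= 0. *)
have [mF _] := MF t tT; have := mF _ _ _ _ Fx0 Fxi.
have -> : xi + eta - x0 - eta = - (x0 - xi).
  by apply/rowP => i; rewrite !mxE; ring.
rewrite dotvNl oppr_ge0 => h.
have x0xi : enorm (x0 - xi) = 0.
  by apply/eqP; rewrite eq_le enorm_ge0 andbT; apply: enorm_le => //; rewrite expr0n.
have [l _ lx] := x0P e 0%N e0; have [_ _ _ _ [_]] := sxyP l.
by have := enorm_distD x0 (sxy l).1.2 xi; rewrite x0xi; lra.
Qed.

End GraphContinuity.

(** * Absolutely continuous functions *)

Section Density.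
Context {R : realType}.
Notation mu := (@lebesgue_measure R).

Lemma abs_cont_interval {V : zmodType} (nrm : V -> R) (a b : R) (f : R -> V) :
  abs_cont nrm a b f -> forall e : R, 0 < e -> exists2 d : R, 0 < d &
    forall s t, a <= s -> s <= t -> t <= b -> t - s < d -> nrm (f t - f s) < e.
Proof.
move=> acf e e0; have [d d0 dP] := acf _ e0; exists d => // s t as_ st tb tsd.
have := dP 1%N (fun=> s) (fun=> t); rewrite !big_ord1; apply => //.
by move=> i j; rewrite !ord1 eqxx.
Qed.

Lemma stieltjes_itv (f : cumulative R R) (a b : R) : a <= b ->
  lebesgue_stieltjes_measure f `]a, b]%classic = (f b - f a)%:E.
Proof.
move=> ab; rewrite /lebesgue_stieltjes_measure /measure_extension/=.
by rewrite measurable_mu_extE/= ?wlength_itv_bnd//; exact: is_ocitv.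
Qed.

Section Stieltjes.
Variables (T : R) (f : R -> R).
Hypotheses (T0 : 0 <= T) (ndf : {in `[0, T] &, {homo f : s t / s <= t}}).
Hypothesis acf : abs_cont (fun r : R => `|r|) 0 T f.

(** Continues [f] by constants outside [[0, T]], as a cumulative function lives on the whole line;
    [clamp] is nondecreasing and 1-Lipschitz, so absolute continuity survives. *)
Let clamp (x : R) := Num.max 0 (Num.min x T).

Let clamp_itv x : 0 <= clamp x <= T.
Proof. by rewrite /clamp le_max lexx ge_max T0 ge_min lexx orbT. Qed.

Let clamp_id x : 0 <= x <= T -> clamp x = x.
Proof. by move=> /andP[x0 xT]; rewrite /clamp min_l// max_r. Qed.

Let clamp_nd : {homo clamp : x y / x <= y}.
Proof.
move=> x y xy; rewrite /clamp; case: (leP x T); case: (leP y T);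
by case: (leP 0 x); case: (leP 0 y); case: (leP 0 T); lra.
Qed.

Let clamp_lip x y : x <= y -> clamp y - clamp x <= y - x.
Proof.
move=> xy; rewrite /clamp; case: (leP x T); case: (leP y T);
by case: (leP 0 x); case: (leP 0 y); case: (leP 0 T); lra.
Qed.

Let fc := f \o clamp.

Let fc_nd : {homo fc : x y / x <= y}.
Proof. by move=> x y xy; apply: ndf; rewrite ?in_itv//=; exact: clamp_nd. Qed.

Let fc_rc : right_continuous fc.
Proof.
move=> x; apply/cvgrPdist_lt => e e0; have [d d0 dP] := abs_cont_interval _ _ _ _ acf _ e0.
near=> y; have xy : x < y by near: y; exact: nbhs_right_gt.
rewrite distrC; have /andP[cx _] := clamp_itv x; have /andP[_ cy] := clamp_itv y.
apply: dP => //; first exact/clamp_nd/ltW.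
apply: le_lt_trans (clamp_lip _ _ (ltW xy)) _; rewrite ltrBlDr.
near: y; apply: nbhs_right_lt; by rewrite ltrDr.
Unshelve. all: by end_near. Qed.

Let F : cumulative R R := HB.pack fc (isCumulative.Build R _ R fc fc_nd fc_rc).

Let nu : {measure set (measurableTypeR R) -> \bar R} := lebesgue_stieltjes_measure F.

Let nu_itv (a b : R) : a <= b -> nu `]a, b]%classic = (fc b - fc a)%:E.
Proof. exact: (stieltjes_itv F). Qed.

Let D : set (measurableTypeR R) := `]0, T]%classic.
Let mD : measurable D. Proof. exact: measurable_itv. Qed.
Let nuD : (nu D < +oo)%E. Proof. by rewrite nu_itv// ltry. Qed.
Let nuT : {finite_measure set (measurableTypeR R) -> \bar R} :=
  @mfrestr _ (measurableTypeR R) R D nu mD nuD.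

(** An open set is a countable disjoint union of open intervals, and each finite subfamily is
    admissible in the definition of absolute continuity. Confinement to a bounded interval makes all
    endpoints finite. *)
Let nu_open (e d : R) (U : set R) :
  (forall (k : nat) (c d' : 'I_k -> R),
      (forall i, 0 <= c i /\ c i <= d' i /\ d' i <= T) ->
      (forall i j, i != j -> d' i <= c j \/ d' j <= c i) ->
      \sum_(i < k) (d' i - c i) < d ->
      \sum_(i < k) `|f (d' i) - f (c i)| < e) ->
  open U -> U `<=` `](-1), (T + 1)[ -> (mu U < d%:E)%E -> (nu U <= e%:E)%E.
Proof.
move=> dP oU UT Ud.
pose I := open_disjoint_itv oU.
have mI i : measurable (I i) by apply: open_measurable; exact: open_disjoint_itv_open.
have UE : U = \bigcup_i I i by exact: open_disjoint_itv_bigcup.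
have tI : trivIset setT I by exact: open_disjoint_itv_trivIset.
have IT i : I i `<=` `](-1), (T + 1)[.
  by move=> x Ix; apply: UT; rewrite UE; exists i.
pose a i := inf (I i); pose b i := sup (I i).
have IE i : I i = `]a i, b i[%classic.
  have [I0|/set0P[x Ix]] := eqVneq (I i) set0.
    by rewrite /a /b I0 inf0 sup0 set_itv_ge// bnd_simp ltxx.
  have hlb : has_lbound (I i).
    by exists (-1) => y /IT /=; rewrite in_itv/= => /andP[/ltW].
  have hub : has_ubound (I i).
    by exists (T + 1) => y /IT /=; rewrite in_itv/= => /andP[_ /ltW].
  rewrite -[LHS](interior_id _).1; last exact: open_disjoint_itv_open.
  by rewrite interval_bounded_interior//; exact: open_disjoint_itv_is_interval.
have ab i : a i <= b i.
  have [I0|/set0P[x]] := eqVneq (I i) set0; first by rewrite /a /b I0 inf0 sup0.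
  by rewrite IE/= in_itv/= => /andP[ax xb]; exact/ltW/(lt_trans ax).
have nuI i : (nu (I i) <= `|f (clamp (b i)) - f (clamp (a i))|%:E)%E.
  apply: (@le_trans _ _ (nu `]a i, b i]%classic)).
    apply: le_measure; rewrite ?inE; [exact: mI|exact: measurable_itv|].
    by rewrite IE; apply: subset_itvl; rewrite bnd_simp.
  by rewrite nu_itv// lee_fin ler_norm.
have muI i : mu (I i) = (b i - a i)%:E.
  rewrite IE lebesgue_measure_itv/= lte_fin; case: ltP => //.
  move=> ba; have -> : b i = a i by apply/eqP; rewrite eq_le ba ab.
  by rewrite subrr.
have sum_mu k : (\sum_(i < k) (b i - a i)%:E <= mu U)%E.
  rewrite (_ : (\sum_(i < k) _)%E = \sum_(i < k) mu (I i))%E; last first.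
    by apply: eq_bigr => i _; rewrite muI.
  rewrite -(big_mkord xpredT (fun i => mu (I i))).
  rewrite UE measure_semi_bigcup//; last by rewrite -UE; exact: open_measurable.
  exact: nneseries_lim_ge.
rewrite UE measure_semi_bigcup//; last by rewrite -UE; exact: open_measurable.
apply: lime_le; first exact: is_cvg_nneseries.
apply: nearW => k /=; rewrite big_mkord.
apply: (@le_trans _ _ (\sum_(i < k) `|f (clamp (b i)) - f (clamp (a i))|%:E)%E).
  by apply: lee_sum => i _; exact: nuI.
rewrite sumEFin lee_fin; apply/ltW/dP.
- move=> i; have /andP[-> _] := clamp_itv (a i); have /andP[_ ->] := clamp_itv (b i).
  by rewrite clamp_nd.
- move=> i j ij.
  have clamp0 : clamp 0 = 0 by apply: clamp_id; rewrite lexx.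
  have [I0|/set0P[x]] := eqVneq (I i) set0.
    left; rewrite /b I0 sup0 clamp0; by have /andP[] := clamp_itv (a j).
  have [I0|/set0P[y]] := eqVneq (I j) set0.
    right; rewrite /b I0 sup0 clamp0; by have /andP[] := clamp_itv (a i).
  rewrite !IE/= !in_itv/= => /andP[ay yb] /andP[ax xb].
  have [bij|abij] := leP (b i) (a j); first by left; exact: clamp_nd.
  have [bji|abji] := leP (b j) (a i); first by right; exact: clamp_nd.
  exfalso; move/trivIsetP : tI => /(_ i j Logic.I Logic.I ij).
  apply/eqP/set0P; exists ((Num.max (a i) (a j) + Num.min (b i) (b j)) / 2).
  by rewrite !IE; split; rewrite /= in_itv/=;
    case: (leP (a i) (a j)) => h1; case: (leP (b i) (b j)) => h2; apply/andP; split; lra.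
rewrite -lte_fin -sumEFin; apply: le_lt_trans Ud; apply: le_trans (sum_mu k).
by apply: lee_sum => i _; rewrite lee_fin clamp_lip.
Qed.

(** Outer regularity covers a null set by an open set of measure below the [d] of absolute
    continuity, which turns the condition on intervals into one on measures. *)
Let nu_dom : nuT `<< mu.
Proof.
apply/null_content_dominatesP => N mN N0.
have mND : measurable (N `&` D) by exact: measurableI.
apply/eqP; rewrite eq_le measure_ge0 andbT; apply/lee_addgt0Pr => e e0.
rewrite add0e; have [d d0 dP] := acf _ e0.
have ND0 : mu (N `&` D) = 0%E.
  by apply/eqP; rewrite eq_le measure_ge0 andbT -N0; exact: measureIl.
have NDoo : (mu (N `&` D) < +oo)%E by rewrite ND0 ltry.
have [U [oU NU Ud]] := @lebesgue_regularity_outer R (N `&` D) d mND NDoo d0.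
pose U' := U `&` `](-1), (T + 1)[%classic.
have oU' : open U' by apply: openI => //; exact: interval_open.
have mU : measurable U by exact: open_measurable.
have Ud' : (mu U' < d%:E)%E.
  apply: (@le_lt_trans _ _ (mu U)); first by apply: measureIl.
  apply: le_lt_trans Ud.
  have -> : mu U = (mu (U `\` (N `&` D)) + mu (U `&` (N `&` D)))%E.
    exact: measureDI.
  rewrite -[leRHS]adde0 leeD2l// -ND0; exact: measureIr.
apply: (@le_trans _ _ (nu U')); last by apply: nu_open dP oU' _ Ud' => x [].
rewrite [leLHS]/(nu (N `&` D)); apply: le_measure; rewrite ?inE//.
  exact: open_measurable.
move=> x [Nx Dx]; split; first by apply: NU.
by move: Dx; rewrite /D/= !in_itv/= => /andP[? ?]; lra.
Qed.

(** [g] is the Radon-Nikodym density of the Stieltjes measure of [f] restricted to []0, T]], where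
    it is finite. *)
Lemma abs_cont_density : exists g : R -> R, [/\ forall x, 0 <= g x,
  mu.-integrable setT (EFin \o g) &
  forall s t, 0 <= s -> s <= t -> t <= T ->
    f t - f s = \int[mu]_(x in `]s, t]) g x].
Proof.
pose h := Radon_Nikodym_SigmaFinite.f nuT mu.
have hE : EFin \o (fine \o h) = h.
  by apply/funext => x /=; rewrite fineK// Radon_Nikodym_SigmaFinite.f_fin_num.
exists (fine \o h); split.
- by move=> x; rewrite /= fine_ge0// Radon_Nikodym_SigmaFinite.f_ge0.
- by rewrite hE; exact: Radon_Nikodym_SigmaFinite.f_integrable.
move=> s t s0 st tT; rewrite /Rintegral.
under eq_integral => x _ do rewrite -[(_ x)%:E]/((EFin \o (fine \o h)) x) hE.
rewrite -Radon_Nikodym_SigmaFinite.f_integral//.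
rewrite [X in fine X](_ : _ = nu `]s, t]%classic).
  by rewrite nu_itv//= /fc/= !clamp_id// ?s0 ?tT ?(le_trans st)// (le_trans s0).
rewrite [LHS]/(nu (_ `&` D)); congr (nu _); apply/seteqP; split=> x /=; first by case.
move=> xst; split => //; move: xst; rewrite /D/= !in_itv/= => /andP[? ?]; lra.
Qed.
End Stieltjes.
End Density.

(** * Primitives of integrable functions and their Lebesgue points *)

Section Primitive.
Context {R : realType}.
Notation mu := (@lebesgue_measure R).
Implicit Type g : R -> R.

Definition primitive g (t : R) : R := \int[mu]_(x in `]-oo, t]) g x.

Lemma integrable_itv g (i : interval R) : mu.-integrable setT (EFin \o g) ->
  mu.-integrable [set` i] (EFin \o g).
Proof. by move=> ig; apply: (integrableS measurableT). Qed.

Lemma primitive_sub g s t : mu.-integrable setT (EFin \o g) -> s <= t ->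
  primitive g t - primitive g s = \int[mu]_(x in `]s, t]) g x.
Proof. by move=> ig st; rewrite /primitive Rintegral_itvB//; exact: integrable_itv. Qed.

Lemma primitive_nd g : mu.-integrable setT (EFin \o g) -> (forall x, 0 <= g x) ->
  {homo primitive g : s t / s <= t}.
Proof.
by move=> ig g0 s t st; rewrite -subr_ge0 primitive_sub// Rintegral_ge0.
Qed.

Lemma primitiveD g h t : mu.-integrable setT (EFin \o g) ->
  mu.-integrable setT (EFin \o h) ->
  primitive (fun x => g x + h x) t = primitive g t + primitive h t.
Proof. by move=> ig ih; rewrite /primitive RintegralD//; exact: integrable_itv. Qed.

Lemma primitiveZ g c t : mu.-integrable setT (EFin \o g) ->
  primitive (fun x => c * g x) t = c * primitive g t.
Proof. by move=> ig; rewrite /primitive RintegralZl//; exact: integrable_itv. Qed.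

Lemma primitive_ac g a b : mu.-integrable setT (EFin \o g) -> (forall x, 0 <= g x) ->
  abs_cont (fun r : R => `|r|) a b (primitive g).
Proof.
move=> ig g0 e e0; have [d [d0 dP]] := integral_normr_continuous ig e0.
exists d => // k u v uv disj sd.
pose I (i : 'I_k) := `]u i, v i]%classic : set R.
have mI i : measurable (I i) by exact: measurable_itv.
have tI : trivIset [set` index_enum 'I_k] I.
  apply/trivIsetP => i j _ _ /disj ij; apply/seteqP; split=> // x [] /=.
  rewrite /I/= !in_itv/= => /andP[? ?] /andP[? ?].
  by have := uv i; have := uv j; case: ij; lra.
pose A := \big[setU/set0]_(i <- index_enum 'I_k) I i.
have mA : measurable A by apply: bigsetU_measurable.
have intU (f : R -> R) : measurable_fun setT f -> (forall x, 0 <= f x) ->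
    (\int[mu]_(x in A) (f x)%:E = \sum_(i < k) \int[mu]_(x in I i) (f x)%:E)%E.
  move=> mf f0; rewrite /A ge0_integral_bigsetU//.
  - exact: index_enum_uniq.
  - by apply/measurable_EFinP; exact: measurable_funS mf.
  - by move=> x _; rewrite lee_fin.
have muA : (mu A < d%:E)%E.
  have -> : mu A = (\sum_(i < k) (v i - u i)%:E)%E.
    rewrite -[LHS]mul1e -integral_cst// (intU (cst 1))//.
    apply: eq_bigr => i _; transitivity (mu (I i)).
      exact: etrans (integral_cst mu (mI i) 1%E) (mul1e _).
    rewrite [LHS]lebesgue_measure_itv/= lte_fin; case: ltP => // vu.
    have -> : v i = u i by have := uv i; lra.
    by rewrite subrr.
  by rewrite sumEFin lte_fin.
have := dP A mA muA; apply: le_lt_trans.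
rewrite -lee_fin /Rintegral fineK; last first.
  apply: integrable_fin_num => //; apply: integrable_norm.
  exact: integrableS ig.
have mg : measurable_fun setT (Num.norm \o g).
  by apply: measurableT_comp => //; case/integrableP : ig => /measurable_EFinP.
rewrite (intU _ mg (fun x => normr_ge0 _)).
rewrite -sumEFin; apply: lee_sum => i _.
have [_ [ui _]] := uv i.
rewrite ger0_norm ?subr_ge0 ?primitive_nd// primitive_sub// /Rintegral fineK; last first.
  exact/integrable_fin_num/integrable_itv.
by under [leRHS]eq_integral do rewrite /= ger0_norm//.
Qed.

Lemma primitive_derivable g : mu.-integrable setT (EFin \o g) ->
  {ae mu, forall t, derivable (primitive g) t 1}.
Proof.
move=> ig; have lg : locally_integrable setT g.
  by apply: open_integrable_locally => //; exact: openT.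
have := FTC1Ny (fun y => integrable_itv _ _ ig) lg.
apply: filterS; first exact: (ae_filter_ringOfSetsType mu).
by move=> t [].
Qed.

(* At a Lebesgue point t of g: the sum is at most the integral of |g - g t| over a
   ball around t. *)
Lemma primitive_strong_derivative g : mu.-integrable setT (EFin \o g) ->
  {ae mu, forall t, forall e : R, 0 < e -> exists2 d0 : R, 0 < d0 &
    forall (d : R) (s : nat -> R) p q, 0 < d < d0 -> {homo s : i j / (i <= j)%N >-> i <= j} ->
      (p <= q)%N -> t - d <= s p -> s q <= t + d ->
      \sum_(p <= k < q) `|primitive g (s k.+1) - primitive g (s k)
         - g t * (s k.+1 - s k)| <= e * d}.
Proof.
move=> ig; have lg : locally_integrable setT g.
  by apply: open_integrable_locally => //; exact: openT.
have := lebesgue_differentiation lg.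
apply: filterS; first exact: (ae_filter_ringOfSetsType mu).
move=> t gt e e0.
(* The cells lie in the open ball of radius [2 * d], of length [4 * d], so a mean below [e / 4]
   integrates to at most [e * d]. *)
have e40 : (0 < (e / 4)%:E)%E by rewrite lte_fin divr_gt0.
have [d0 /= d00 dP] : \forall r \near 0^'+, (davg g t r < (e / 4)%:E)%E.
  apply: (gt [set y | (y < (e / 4)%:E)%E]).
  by apply: open_nbhs_nbhs; split => //; exact: open_ereal_lt_ereal.
exists (d0 / 2); first by rewrite divr_gt0.
move=> d s p q /andP[dp dd0] nds pq tsp sqt.
have dle : (davg g t (2 * d) < (e / 4)%:E)%E.
  apply: dP => /=; last by rewrite mulr_gt0.
  by rewrite sub0r normrN gtr0_norm ?mulr_gt0//; lra.
pose h x := `|g x - g t|.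
have itv_length a b : a <= b -> fine (mu `]a, b]%classic) = b - a.
  move=> ab; rewrite lebesgue_measure_itv/= lte_fin; case: ltP => //= ba.
  have -> : b = a by lra.
  by rewrite subrr.
have ic a b : mu.-integrable `]a, b] (EFin \o cst (g t)).
  apply: measurable_bounded_integrable => //.
  - by rewrite /= lebesgue_measure_itv/=; case: ifPn => _; rewrite ltry.
  - by exists `|g t|; split; [exact: num_real|move=> M tM x _ /=; exact: ltW].
have igt a b : mu.-integrable `]a, b] (EFin \o (fun x => g x - g t)).
  rewrite (_ : EFin \o _ = ((EFin \o g) \- (EFin \o cst (g t)))%E)//.
  by apply: integrableB => //; exact: integrable_itv.
have ih a b : mu.-integrable `]a, b] (EFin \o h).
  by apply: integrable_norm; exact: igt.
have cell a b : a <= b -> `|primitive g b - primitive g a - g t * (b - a)|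
    <= \int[mu]_(x in `]a, b]) h x.
  move=> ab; rewrite primitive_sub// -(itv_length _ _ ab) -Rintegral_cst//.
  rewrite -RintegralB//; last exact: integrable_itv.
  exact: le_normr_Rintegral.
apply: (@le_trans _ _ (\int[mu]_(x in `]s p, s q]) h x)).
  rewrite -(subnKC pq); elim: (q - p)%N => [|m IH].
    by rewrite addn0 big_geq//; apply: Rintegral_ge0 => x _; exact: normr_ge0.
  rewrite addnS big_nat_recr ?leq_addr//=.
  rewrite -[leRHS](subrK (\int[mu]_(x in `]s p, s (p + m)%N]) h x)).
  have pm : s p <= s (p + m)%N by apply: nds; exact: leq_addr.
  have pm1 : s (p + m)%N <= s (p + m).+1 by exact: nds.
  rewrite (@Rintegral_itvB R h (BRight (s p)) (BRight (s (p + m).+1)) _ (ih _ _)) ?bnd_simp//.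
  by rewrite addrC lerD// cell.
rewrite -lee_fin /Rintegral fineK; last exact: integrable_fin_num.
have : (\int[mu]_(x in ball t (2 * d)) `|(g x - g t)%:E| < (e * d)%:E)%E.
  move: dle; rewrite /davg /iavg lebesgue_measure_ball ?mulr_ge0 ?ltW// inver.
  rewrite gt_eqF ?mulrn_wgt0 ?mulr_gt0// lte_pdivrMl ?mulrn_wgt0 ?mulr_gt0//.
  by rewrite -EFinM (_ : 2 * d *+ 2 * (e / 4) = e * d)// -mulr_natl; field.
move=> /ltW; apply: le_trans; apply: ge0_subset_integral => //.
- exact: measurable_ball.
- apply/measurable_EFinP/measurableT_comp => //; apply: measurable_funB => //.
  by case/integrableP : ig => /measurable_EFinP mg _; exact: measurable_funS mg.
- by move=> x _; rewrite lee_fin normr_ge0.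
- rewrite ball_itv; apply: subset_itv; rewrite bnd_simp; lra.
Qed.

End Primitive.

(** * The time-stepping scheme *)

Section Node.
Context {R : realType}.
Notation mu := (@lebesgue_measure R).

(** With [A0], [A1] the brackets on the right, the integral of s0/A0 + s1/A1 over the cell is below
    2, so the sum is below 2/(b - a) somewhere, and there so is each summand. The added [b - a]
    keeps [A0] and [A1] positive. *)
Lemma common_node (s0 s1 : R -> R) (a b : R) : a < b ->
  (forall x, 0 <= s0 x) -> (forall x, 0 <= s1 x) ->
  mu.-integrable setT (EFin \o s0) -> mu.-integrable setT (EFin \o s1) ->
  exists t, [/\ a <= t <= b,
    (b - a) * s0 t <= 2 * (primitive s0 b - primitive s0 a + (b - a)) &
    (b - a) * s1 t <= 2 * (primitive s1 b - primitive s1 a + (b - a))].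
Proof.
move=> ab s00 s10 i0 i1.
set A0 := _ + (b - a); set A1 := primitive s1 b - _ + _.
have ba : 0 < b - a by rewrite subr_gt0.
have d0 : 0 <= primitive s0 b - primitive s0 a by rewrite subr_ge0 primitive_nd// ltW.
have d1 : 0 <= primitive s1 b - primitive s1 a by rewrite subr_ge0 primitive_nd// ltW.
have A00 : 0 < A0 by rewrite ltr_wpDl.
have A10 : 0 < A1 by rewrite ltr_wpDl.
apply: contrapT => nt.
pose h x := A0^-1 * s0 x + A1^-1 * s1 x.
have lb x : `]a, b]%classic x -> 2 / (b - a) <= h x.
  rewrite /= in_itv/= => /andP[ax xb]; rewrite leNgt; apply/negP => hx; apply: nt.
  exists x; split; first by rewrite (ltW ax).
    have : A0^-1 * s0 x < 2 / (b - a).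
      by apply: le_lt_trans hx; rewrite lerDl mulr_ge0// invr_ge0 ltW.
    rewrite mulrC ltr_pdivrMr// mulrAC ltr_pdivlMr// => /ltW; lra.
  have : A1^-1 * s1 x < 2 / (b - a).
    by apply: le_lt_trans hx; rewrite lerDr mulr_ge0// invr_ge0 ltW.
  rewrite mulrC ltr_pdivrMr// mulrAC ltr_pdivlMr// => /ltW; lra.
have iz s c : mu.-integrable setT (EFin \o s) -> mu.-integrable setT (EFin \o (fun x => c * s x)).
  move=> i; rewrite (_ : EFin \o _ = (fun x => c%:E * (EFin \o s) x)%E)//.
  exact: integrableZl.
have ih : mu.-integrable setT (EFin \o h).
  rewrite (_ : EFin \o _ = ((EFin \o (fun x => (A0^-1 * s0 x)%R)) \+
    (EFin \o (fun x => (A1^-1 * s1 x)%R)))%E)//.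
  by apply: integrableD => //; exact: iz.
have icst : mu.-integrable `]a, b] (EFin \o cst (2 / (b - a))).
  apply: measurable_bounded_integrable => //.
  - by rewrite /= lebesgue_measure_itv/=; case: ifPn => _; rewrite ltry.
  - by exists `|2 / (b - a)|; split; [exact: num_real|move=> M tM x _ /=; exact: ltW].
have mab : measurable (`]a, b]%classic : set (measurableTypeR R)).
  exact: measurable_itv.
have := le_Rintegral mab icst (integrable_itv _ _ ih) lb.
rewrite -(primitive_sub _ _ _ ih (ltW ab)).
rewrite !(primitiveD _ _ _ (iz _ _ i0) (iz _ _ i1)) !(primitiveZ _ _ _ i0) !(primitiveZ _ _ _ i1).
rewrite Rintegral_cst//.
have -> : fine (mu `]a, b]%classic) = b - a by rewrite lebesgue_measure_itv/= lte_fin ab.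
rewrite divfK ?gt_eqF//.
have -> : A0^-1 * primitive s0 b + A1^-1 * primitive s1 b -
  (A0^-1 * primitive s0 a + A1^-1 * primitive s1 a) =
  2 - (b - a) / A0 - (b - a) / A1.
  by rewrite /A0 /A1; field; rewrite -/A0 -/A1 ?gt_eqF.
have : 0 < (b - a) / A0 by rewrite divr_gt0.
have : 0 < (b - a) / A1 by rewrite divr_gt0.
lra.
Qed.

End Node.

Section Domains.
Context {R : realType} {n : nat}.
Local Notation vec := 'rV[R]_n.

(** Half of [e] moves [z] from the closure into the domain, the other half pays for an infimum that
    need not be attained. Maximality makes the target domain nonempty. *)
Lemma dom_step (F : R -> vec -> set vec) (T : R) (phi : R -> R) :
  (forall t, 0 <= t <= T -> maximal_monotone (F t)) ->
  (forall s t, 0 <= s -> s <= t -> t <= T ->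
     forall z, sdom (F s) z -> vdist z (sdom (F t)) <= phi t - phi s) ->
  forall (s t e : R) z, 0 <= s -> s <= t -> t <= T -> 0 < e ->
    closure (sdom (F s)) z ->
    exists2 p, sdom (F t) p & enorm (z - p) <= phi t - phi s + e.
Proof.
move=> MF A2 s t e z s0 st tT e0 /closure_enorm zs.
have e20 : 0 < e / 2 by rewrite divr_gt0.
have [y sy zy] := zs _ e20.
have tT' : 0 <= t <= T by rewrite tT (le_trans s0).
have [|_ [p tp <-] yp] := @inf_adherent _ [set enorm (y - p) | p in sdom (F t)] (e / 2) e20.
  split.
    have [a [b Fab]] := maximal_monotone_nonempty _ (MF _ tT').
    by exists (enorm (y - a)), a => //; exists b.
  by exists 0 => _ [p _ <-]; exact: enorm_ge0.
exists p => //; have := A2 _ _ s0 st tT _ sy; rewrite /vdist.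
by have := enorm_distD y z p; lra.
Qed.

End Domains.

Section AbsCont.
Context {R : realType}.

Lemma abs_cont_le {V W : zmodType} (nV : V -> R) (nW : W -> R) (a b C : R)
    (f : R -> V) (g : R -> W) : 0 < C ->
  (forall c d, a <= c -> c <= d -> d <= b -> nW (g d - g c) <= C * nV (f d - f c)) ->
  abs_cont nV a b f -> abs_cont nW a b g.
Proof.
move=> C0 gf acf e e0; have [|d d0 dP] := acf (e / C); first by rewrite divr_gt0.
exists d => // k u v uv disj sd; have := dP k u v uv disj sd.
rewrite ltr_pdivlMr//; apply: le_lt_trans; rewrite mulrC mulr_sumr.
by apply: ler_sum => i _; have [? []] := uv i; exact: gf.
Qed.

Lemma abs_contD {V : zmodType} (nrm : V -> R) (a b : R) (f g : R -> V) :
  (forall u v, nrm (u + v) <= nrm u + nrm v) ->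
  abs_cont nrm a b f -> abs_cont nrm a b g -> abs_cont nrm a b (fun t => f t + g t).
Proof.
move=> nrmD acf acg e e0; have e20 : 0 < e / 2 by rewrite divr_gt0.
have [d d0 dP] := acf _ e20; have [d' d'0 d'P] := acg _ e20.
exists (Num.min d d'); first by rewrite lt_min d0.
move=> k u v uv disj; rewrite lt_min => /andP[sd sd'].
apply: (@le_lt_trans _ _ (\sum_(i < k) (nrm (f (v i) - f (u i)) + nrm (g (v i) - g (u i))))).
  apply: ler_sum => i _; apply: le_trans (nrmD _ _).
  by rewrite opprD addrACA.
rewrite big_split/=; have := dP _ _ _ uv disj sd; have := d'P _ _ _ uv disj sd'; lra.
Qed.

Lemma abs_cont_id (a b : R) : abs_cont (fun r : R => `|r|) a b (fun t => t).
Proof.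
move=> e e0; exists e => // k u v uv _; apply: le_lt_trans.
by apply: ler_sum => i _; have [_ [? _]] := uv i; rewrite ger0_norm// subr_ge0.
Qed.

End AbsCont.

(** * Construction of the scheme and its a priori bounds *)

Section Scheme.
Context {R : realType} {n : nat}.
Local Notation vec := 'rV[R]_n.
Notation mu := (@lebesgue_measure R).
Variables (T : R) (F : R -> vec -> set vec).
Hypothesis T0 : 0 < T.
Hypothesis MF : forall t : R, 0 <= t <= T -> maximal_monotone (F t).
Variable phi : R -> R.
Hypothesis phi_nd : {in `[0, T] &, {homo phi : s t / s <= t}}.
Hypothesis phi_ac : abs_cont (fun r : R => `|r|) 0 T phi.
Hypothesis phi_dom : forall s t : R, 0 <= s -> s <= t -> t <= T ->
  forall z, sdom (F s) z -> vdist z (sdom (F t)) <= phi t - phi s.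
Hypothesis minsec_growth : forall r : R, 0 < r -> exists sigma : R -> R,
  (forall t : R, 0 <= t <= T -> 0 <= sigma t) /\
  mu.-integrable `[0, T] (EFin \o sigma) /\
  (forall (t : R) x, 0 <= t <= T -> enorm x <= r -> sdom (F t) x ->
     enorm (minsec (F t) x) <= sigma t * (1 + enorm x)).
Variable x0 : vec.
Hypothesis x0_dom : closure (sdom (F 0)) x0.

Definition grid (N k : nat) : R := k%:R * (T / N%:R).

(** The graph point [(p, u)] is the bounded reference that [graph_inner_semicontinuous] asks for;
    its velocity is controlled by the mass of the cell. The step bound reaches back to [k.-1]
    because [x_ k] belongs to a node somewhere in the previous cell. *)
Definition is_scheme (M : R) (P : R -> R) (N : nat) (t_ : nat -> R) (x_ : nat -> vec) :=
  let l := T / N%:R in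
  let m k := P (grid N k.+1) - P (grid N k) in
  [/\ x_ 0%N = x0, forall k, (k <= N)%N -> enorm (x_ k) <= M &
   forall k, (k < N)%N ->
   [/\ grid N k <= t_ k <= grid N k.+1,
     F (t_ k) (x_ k.+1) (l^-1 *: (x_ k - x_ k.+1)),
     exists p u, [/\ F (t_ k) p u, enorm p <= M & l * enorm u <= m k] &
     enorm (x_ k.+1 - x_ k) <= P (grid N k.+1) - P (grid N k.-1)]].

Lemma grid_ge0 N k : 0 <= grid N k.
Proof. by rewrite /grid mulr_ge0// divr_ge0// ltW. Qed.

Lemma gridS N k : grid N k.+1 = grid N k + T / N%:R.
Proof. by rewrite /grid -natr1 mulrDl mul1r. Qed.

Lemma grid_homo N : {homo grid N : i j / (i <= j)%N >-> i <= j}.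
Proof.
by move=> i j ij; rewrite /grid ler_wpM2r ?ler_nat// divr_ge0// ltW.
Qed.

Lemma gridN N : (0 < N)%N -> grid N N = T.
Proof. by move=> N0; rewrite /grid mulrC divfK// pnatr_eq0 -lt0n. Qed.

Lemma grid_le N k : (0 < N)%N -> (k <= N)%N -> grid N k <= T.
Proof. by move=> N0 kN; rewrite -(gridN _ N0); exact: grid_homo. Qed.

Lemma sigma_ext r : 0 < r -> exists s : R -> R, [/\ forall t, 0 <= s t,
  mu.-integrable setT (EFin \o s) &
  forall t x, 0 <= t <= T -> enorm x <= r -> sdom (F t) x ->
     enorm (minsec (F t) x) <= s t * (1 + enorm x)].
Proof.
move=> /minsec_growth[sg [sg0 [isg sgP]]].
exists (sg \_ `[0, T]); split.
- move=> t; rewrite patchE; case: ifPn => //.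
  by rewrite inE/= in_itv/= => /sg0.
- rewrite -restrict_EFin -integrable_mkcond//; exact: measurable_itv.
move=> t x tT; rewrite patchE ifT; first exact: sgP.
by rewrite inE/= in_itv.
Qed.

Let previous_node (t_ : nat -> R) k := if k is k'.+1 then t_ k' else 0.

(** The coefficients of the dominating function come from |x_{k+1} - x_k| <= 2 |p - x_k| + l |u|,
    where [p] is a domain point at the new node with |p - x_k| at most the increment of [phi] plus
    [l], and [u] is its minimal section, bounded through [s1]. *)
Lemma scheme_run (s0 s1 : R -> R) (R0 R1 : R) N :
  let D := phi T - phi 0 + T in
  (0 < N)%N ->
  (forall t, 0 <= s0 t) -> mu.-integrable setT (EFin \o s0) ->
  (forall t, 0 <= s1 t) -> mu.-integrable setT (EFin \o s1) ->
  R0 = enorm x0 + D ->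
  R1 = R0 + D + (1 + R0) * (2 * (primitive s0 T - primitive s0 0 + T)) + D ->
  (forall (t : R) x, 0 <= t <= T -> enorm x <= R0 -> sdom (F t) x ->
     enorm (minsec (F t) x) <= s0 t * (1 + enorm x)) ->
  (forall (t : R) x, 0 <= t <= T -> enorm x <= R1 -> sdom (F t) x ->
     enorm (minsec (F t) x) <= s1 t * (1 + enorm x)) ->
  exists t_ x_, is_scheme R1 (fun t => 2 * phi t +
    (2 * (1 + R1)) * primitive s1 t + (2 + 2 * (1 + R1)) * t) N t_ x_.
Proof.
move=> D N0 s00 is0 s10 is1 R0E R1E s0P s1P.
set l := T / N%:R.
have l0 : 0 < l by rewrite divr_gt0// ltr0n.
have D0 : 0 <= D.
  by rewrite /D addr_ge0 ?(ltW T0)// subr_ge0 phi_nd ?in_itv/= ?lexx ?(ltW T0).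
have R00 : 0 <= R0 by rewrite R0E addr_ge0 ?enorm_ge0.
have S0nd := primitive_nd _ is0 s00.
have S1nd := primitive_nd _ is1 s10.
have R10 : 0 <= R1.
  have S0T := S0nd _ _ (ltW T0).
  have : 0 <= (1 + R0) * (2 * (primitive s0 T - primitive s0 0 + T)).
    by apply: mulr_ge0; first lra; have := T0; lra.
  rewrite R1E; lra.
have gridl k : grid N k.+1 - grid N k = l by rewrite gridS addrC addKr.
have /choice[t_ t_P] : forall k, exists t, [/\ grid N k <= t <= grid N k.+1,
    l * s0 t <= 2 * (primitive s0 (grid N k.+1) - primitive s0 (grid N k) + l) &
    l * s1 t <= 2 * (primitive s1 (grid N k.+1) - primitive s1 (grid N k) + l)].
  move=> k; rewrite -(gridl k); apply: common_node => //.
  by rewrite gridS ltrDl.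
pose tp := previous_node t_.
have tp_grid k : grid N k.-1 <= tp k <= grid N k.
  by case: k => [|k]; [rewrite /grid/= mul0r lexx|have [] := t_P k].
have tp_t k : tp k <= t_ k.
  by have /andP[_ h] := tp_grid k; have [/andP[h' _] _ _] := t_P k; exact: le_trans h'.
have tp0 k : 0 <= tp k.
  by have /andP[h _] := tp_grid k; apply: le_trans h; exact: grid_ge0.
have tT k : (k < N)%N -> t_ k <= T.
  by move=> kN; have [/andP[_ h] _ _] := t_P k; apply: le_trans h _; exact: grid_le.
have tpT k : (k <= N)%N -> tp k <= T by case: k => [|k] kN; [exact: ltW|exact: tT].
have tIT k : (k < N)%N -> 0 <= t_ k <= T.
  by move=> kN; rewrite tT// andbT; exact: le_trans (tp0 k) _.
have phi_le s t : 0 <= s -> s <= t -> t <= T -> phi s <= phi t.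
  move=> s0' st tT'; apply: phi_nd => //; rewrite in_itv/=; first by rewrite s0' (le_trans st).
  by rewrite tT' (le_trans s0').
have step k z : (k < N)%N -> closure (sdom (F (tp k))) z ->
    exists2 p, sdom (F (t_ k)) p & enorm (z - p) <= phi (t_ k) - phi (tp k) + l.
  by move=> kN; apply: (dom_step _ T phi MF phi_dom) => //; exact: tT.
pose res k z := xget 0 [set x | F (t_ k) x (l^-1 *: (z - x))].
have resP k z : (k < N)%N -> F (t_ k) (res k z) (l^-1 *: (z - res k z)).
  move=> kN; rewrite /res; case: xgetP => [x -> //|none]; exfalso.
  by have [x /none] := minty _ _ z (MF _ (tIT _ kN)) l0.
pose x_ := nat_rect (fun=> vec) x0 res.
(* The comparison sequence [w_] built from [nxt] moves from domain to domain and ignores the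
   velocities, so its bound [R0] involves no [sigma]. *)
pose nxt k z := xget 0 [set p | sdom (F (t_ k)) p /\
                           enorm (z - p) <= phi (t_ k) - phi (tp k) + l].
have nxtP k z : (k < N)%N -> closure (sdom (F (tp k))) z ->
    sdom (F (t_ k)) (nxt k z) /\ enorm (z - nxt k z) <= phi (t_ k) - phi (tp k) + l.
  move=> kN cz; rewrite /nxt; case: xgetP => [x -> //|none]; exfalso.
  by have [p p1 p2] := step _ _ kN cz; exact: (none p).
pose w_ := nat_rect (fun=> vec) x0 nxt.
have w_dom k : (k <= N)%N -> closure (sdom (F (tp k))) (w_ k).
  elim: k => [//|k IH] kN; apply: subset_closure.
  by have [] := nxtP _ _ kN (IH (ltnW kN)).
have x_dom k : (k <= N)%N -> closure (sdom (F (tp k))) (x_ k).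
  case: k => [//|k] kN; apply: subset_closure.
  by exists (l^-1 *: (x_ k - x_ k.+1)); exact: resP.
have w_x0 k : (k <= N)%N -> enorm (w_ k - x0) <= phi (tp k) - phi 0 + grid N k.
  elim: k => [|k IH] kN; first by rewrite !subrr enorm0 /grid mul0r addr0.
  have := IH (ltnW kN); have [_] := nxtP _ _ kN (w_dom _ (ltnW kN)).
  rewrite -/(w_ k.+1) enormB gridS -/l -[tp k.+1]/(t_ k).
  by have := enorm_distD (w_ k) (w_ k.+1) x0; lra.
have w_R0 k : (k <= N)%N -> enorm (w_ k) <= R0.
  move=> kN; apply: le_trans (enorm_subD _ x0) _; rewrite R0E addrC lerD2l.
  apply: le_trans (w_x0 _ kN) _; rewrite /D lerD ?grid_le// lerD2r.
  by apply: phi_le => //; exact: tpT.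
have minsec_step k p : (k < N)%N -> sdom (F (t_ k)) p ->
    enorm (res k p - p) <= l * enorm (minsec (F (t_ k)) p).
  move=> kN dp; have [mF _] := MF _ (tIT _ kN).
  apply: resolvent_step mF l0 (resP _ _ kN) _.
  by apply: minsec_in => //; exact/MF/tIT.
have res_lip k z z' : (k < N)%N -> enorm (res k z - res k z') <= enorm (z - z').
  move=> kN; have [mF _] := MF _ (tIT _ kN).
  exact: resolvent_dist mF l0 (resP _ _ kN) (resP _ _ kN).
(* Resolvents being nonexpansive, the gap grows in one step only by the move of [w_] and by the
   displacement of the resolvent at [w_ k.+1], which [s0] controls. *)
have x_w k : (k <= N)%N -> enorm (x_ k - w_ k) <= phi (tp k) - phi 0 + grid N k +
    (1 + R0) * (2 * (primitive s0 (grid N k) - primitive s0 0 + grid N k)).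
  elim: k => [|k IH] kN; first by rewrite !subrr enorm0 /grid mul0r !addr0 subrr !mulr0.
  have [dw ww] := nxtP _ _ kN (w_dom _ (ltnW kN)).
  have h1 := enorm_distD (res k (w_ k.+1)) (x_ k.+1) (w_ k.+1).
  have h2 := res_lip _ (x_ k) (w_ k.+1) kN.
  have h3 := enorm_distD (w_ k) (x_ k) (w_ k.+1).
  have h4 := minsec_step _ _ kN dw.
  have h5 := s0P _ _ (tIT _ kN) (w_R0 _ kN) dw.
  have [_ h6 _] := t_P k.
  have h7 : l * enorm (minsec (F (t_ k)) (w_ k.+1)) <=
      (1 + R0) * (2 * (primitive s0 (grid N k.+1) - primitive s0 (grid N k) + l)).
    apply: (@le_trans _ _ (l * (s0 (t_ k) * (1 + R0)))).
      rewrite ler_pM2l//; apply: le_trans h5 _; rewrite ler_wpM2l// lerD2l.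
      exact: w_R0.
    by rewrite mulrA mulrC ler_wpM2l// addr_ge0.
  have := IH (ltnW kN); rewrite -[tp k.+1]/(t_ k).
  change (x_ k.+1) with (res k (x_ k)) in h1 |- *.
  change (nxt k (w_ k)) with (w_ k.+1) in ww.
  change (nxt k (w_ k)) with (w_ k.+1) in h4.
  rewrite gridS -/l in h7 *; lra.
(* The final [D] in [R1] is held in reserve: the points [p] used below lie within [D] of [x_ k] and
   must stay in the ball of radius [R1]. *)
have x_R k : (k <= N)%N -> enorm (x_ k) <= R1 - D.
  move=> kN; apply: le_trans (enorm_subD _ (w_ k)) _.
  have := w_R0 _ kN; have := x_w _ kN.
  have : phi (tp k) - phi 0 + grid N k <= D.
    by rewrite /D lerD ?grid_le// lerD2r; apply: phi_le => //; exact: tpT.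
  have : (1 + R0) * (2 * (primitive s0 (grid N k) - primitive s0 0 + grid N k)) <=
      (1 + R0) * (2 * (primitive s0 T - primitive s0 0 + T)).
    rewrite ler_wpM2l ?addr_ge0// ler_pM2l// lerD ?grid_le// lerD2r.
    by apply: S0nd; exact: grid_le.
  rewrite R1E; lra.
exists t_, x_; split => // [k kN|k kN].
  by apply: le_trans (x_R _ kN) _; rewrite lerBlDr lerDl.
have [p dp xp] := step _ _ kN (x_dom _ (ltnW kN)).
have phiD : phi (t_ k) - phi (tp k) + l <= D.
  have : phi (t_ k) <= phi T by apply: phi_le (tT _ kN) _ => //; exact: le_trans (tp0 k) _.
  have : phi 0 <= phi (tp k) by apply: phi_le => //; exact/tpT/ltnW.
  have : l <= T by rewrite /l ler_pdivrMr ?ltr0n// ler_peMr ?(ltW T0)// ler1n.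
  rewrite /D; lra.
have pR : enorm p <= R1.
  apply: le_trans (enorm_subD _ (x_ k)) _; rewrite enormB.
  have := x_R _ (ltnW kN); lra.
have [tk _ tk1] := t_P k.
have l_u : l * enorm (minsec (F (t_ k)) p) <=
    2 * (1 + R1) * (primitive s1 (grid N k.+1) - primitive s1 (grid N k) + l).
  apply: (@le_trans _ _ (l * (s1 (t_ k) * (1 + R1)))).
    rewrite ler_pM2l//; apply: le_trans (s1P _ _ (tIT _ kN) pR dp) _.
    by rewrite ler_wpM2l// lerD2l.
  by have := ler_wpM2l (addr_ge0 ler01 R10) tk1; lra.
have phi1 : phi (t_ k) - phi (tp k) <= phi (grid N k.+1) - phi (grid N k.-1).
  have /andP[h1 h2] := tp_grid k; have /andP[h3 h4] := tk.
  have := phi_le _ _ (le_trans (tp0 k) (tp_t k)) h4 (grid_le _ _ N0 kN).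
  have := phi_le _ _ (grid_ge0 _ _) h1 (tpT _ (ltnW kN)); lra.
have phi2 : phi (grid N k) <= phi (grid N k.+1).
  by apply: phi_le; [exact: grid_ge0|exact: grid_homo|exact: grid_le].
have S12 : primitive s1 (grid N k) <= primitive s1 (grid N k.+1).
  by apply: S1nd; exact: grid_homo.
have S12p : primitive s1 (grid N k.-1) <= primitive s1 (grid N k).
  by apply: S1nd; apply: grid_homo; exact: leq_pred.
have g12 : grid N k.-1 <= grid N k by apply: grid_homo; exact: leq_pred.
split => //.
- exact: resP.
- exists p, (minsec (F (t_ k)) p); split => //.
    by apply: minsec_in => //; exact/MF/tIT.
  apply: le_trans l_u _; rewrite gridS -/l in phi2 *; lra.
- have h1 := enorm_distD (res k p) (x_ k.+1) (x_ k).
  have h2 := enorm_distD p (res k p) (x_ k).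
  have h3 := res_lip _ (x_ k) p kN.
  have h4 := minsec_step _ _ kN dp.
  change (x_ k.+1) with (res k (x_ k)) in h1 |- *; rewrite (enormB p) in h2.
  have q1 : 0 <= (2 * (1 + R1)) * (primitive s1 (grid N k) - primitive s1 (grid N k.-1)).
    by apply: mulr_ge0; [have := R10; lra|rewrite subr_ge0].
  have q2 : 0 <= (2 + 2 * (1 + R1)) * (grid N k - grid N k.-1).
    by apply: mulr_ge0; [have := R10; lra|rewrite subr_ge0].
  have -> : (2 * phi (grid N k.+1) + 2 * (1 + R1) * primitive s1 (grid N k.+1) +
    (2 + 2 * (1 + R1)) * grid N k.+1 - (2 * phi (grid N k.-1) + 2 * (1 + R1) *
    primitive s1 (grid N k.-1) + (2 + 2 * (1 + R1)) * grid N k.-1)) =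
    2 * (phi (grid N k.+1) - phi (grid N k.-1)) + 2 * (1 + R1) *
    (primitive s1 (grid N k.+1) - primitive s1 (grid N k) + l) + 2 * l +
    (2 * (1 + R1)) * (primitive s1 (grid N k) - primitive s1 (grid N k.-1)) +
    (2 + 2 * (1 + R1)) * (grid N k - grid N k.-1).
    by rewrite -(gridl k); ring.
  move: l_u phi1 q1 q2; lra.
Qed.

(** [P] enters the scheme only through its increments, so the explicit dominating function can be
    exchanged for the primitive of its density. *)
Lemma is_scheme_ext M P Q N t_ x_ : (0 < N)%N ->
  (forall s t, 0 <= s -> s <= t -> t <= T -> P t - P s = Q t - Q s) ->
  is_scheme M P N t_ x_ -> is_scheme M Q N t_ x_.
Proof.
move=> N0 PQ [x_0 xM xP]; split=> // k kN; have := xP k kN.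
rewrite !PQ//; try exact: grid_ge0; try exact: grid_homo; try exact: grid_le.
by apply: grid_homo; exact: leq_trans (leq_pred k) (leqnSn k).
Qed.

Lemma scheme_exists : exists (M : R) (g : R -> R), [/\ forall x, 0 <= g x,
  mu.-integrable setT (EFin \o g) &
  forall N, (0 < N)%N -> exists t_ x_, is_scheme M (primitive g) N t_ x_].
Proof.
pose D := phi T - phi 0 + T.
have D0 : 0 < D.
  by rewrite ltr_wpDl// subr_ge0 phi_nd ?in_itv/= ?lexx ?(ltW T0).
pose R0 := enorm x0 + D.
have R00 : 0 < R0 by rewrite ltr_wpDl ?enorm_ge0.
have [s0 [s00 is0 s0P]] := sigma_ext _ R00.
pose R1 := R0 + D + (1 + R0) * (2 * (primitive s0 T - primitive s0 0 + T)) + D.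
have R10 : 0 < R1.
  have S0T := primitive_nd _ is0 s00 _ _ (ltW T0).
  have : 0 <= (1 + R0) * (2 * (primitive s0 T - primitive s0 0 + T)).
    by apply: mulr_ge0; first lra; have := T0; lra.
  rewrite /R1; lra.
have [s1 [s10 is1 s1P]] := sigma_ext _ R10.
pose P t := 2 * phi t + (2 * (1 + R1)) * primitive s1 t + (2 + 2 * (1 + R1)) * t.
have A0 : 0 < 2 * (1 + R1) by lra.
have B0 : 0 < 2 + 2 * (1 + R1) by lra.
have Pnd : {in `[0, T] &, {homo P : s t / s <= t}}.
  move=> s t sT tT st; rewrite /P lerD ?ler_pM2l// lerD// ler_pM2l//; first exact: phi_nd.
  exact: primitive_nd.
have scale f C : 0 < C -> abs_cont (fun r : R => `|r|) 0 T f ->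
    abs_cont (fun r : R => `|r|) 0 T (fun t => C * f t).
  move=> C0; apply: (abs_cont_le _ _ _ _ C) => // c d _ _ _.
  by rewrite -mulrBr normrM gtr0_norm.
have Pac : abs_cont (fun r : R => `|r|) 0 T P.
  have normD := @ler_normD _ R.
  apply: abs_contD => //; first apply: abs_contD => //; apply: scale => //.
  - exact: primitive_ac.
  - exact: abs_cont_id.
have [g [g0 ig gP]] := abs_cont_density _ _ (ltW T0) Pnd Pac.
exists R1, g; split => // N N0.
have [t_ [x_ tx]] := scheme_run s0 s1 R0 R1 N N0 s00 is0 s10 is1 erefl erefl s0P s1P.
exists t_, x_; apply: is_scheme_ext tx => // s t s_0 st tT.
by rewrite primitive_sub// -gP.
Qed.

End Scheme.

(** * Passage to the limit *)

Section Window.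
Context {R : realType} {n : nat}.
Local Notation vec := 'rV[R]_n.

(* Cells are good when their mass is at most (ell + 1) l. On good cells the monotonicity
   inequality against (xi, eta) holds up to e; a bad cell has a defect
   |m k - ell l| of at least l, so bad cells are controlled by the total defect E. *)
Lemma window_estimate (l ell e e0 E L : R) (m : nat -> R) (x_ : nat -> vec)
    (X0 xi eta : vec) (p q : nat) :
  0 < l -> 0 <= ell -> 0 <= e -> (0 < p)%N -> (p <= q)%N ->
  (forall k, 0 <= m k) ->
  (forall k, (p <= k < q)%N -> enorm (x_ k.+1 - x_ k) <= m k + m k.-1) ->
  \sum_(p.-1 <= k < q) `|m k - ell * l| <= E ->
  (forall k, (p <= k < q)%N -> m k <= (ell + 1) * l -> exists xi' eta',
     [/\ enorm (xi' - xi) <= e, enorm (eta' - eta) <= e &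
        dotv (x_ k.+1 - x_ k + l *: eta') (x_ k.+1 - xi') <= 0]) ->
  enorm (x_ p - X0) <= e0 ->
  L = (q - p)%:R * l ->
  dotv (x_ q - x_ p + L *: eta) (X0 - xi) <=
    (2 * E + 2 * ell * L + L * (enorm eta + e)) * (e + (e0 + 2 * E + 2 * ell * L)) +
    L * e * enorm (X0 - xi) + enorm (X0 - xi) * (2 + 2 * ell + enorm eta) * E.
Proof.
move=> l0 ell0 e_ge0 p0 pq m0 xm dE good xp LE.
pose d k := `|m k - ell * l|.
have d_ge0 k : 0 <= d k by exact: normr_ge0.
have md k : m k <= d k + ell * l by have := ler_norm (m k - ell * l); rewrite -/(d k); lra.
have sumE a b : (p.-1 <= a)%N -> (b <= q)%N -> \sum_(a <= k < b) d k <= E.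
  move=> pa bq; apply: le_trans dE.
  have [ab|ba] := leqP a b; last by rewrite [leLHS]big_geq ?sumr_ge0// ltnW.
  rewrite (big_cat_nat pa (leq_trans ab bq))/= (big_cat_nat ab bq)/=.
  by rewrite addrCA lerDl addr_ge0// sumr_ge0.
(* Step [k] also charges the cell before it, which is why the total defect starts at [p.-1]. *)
have sumE1 b : (b <= q)%N -> (p <= b)%N -> \sum_(p <= k < b) d k.-1 <= E.
  move=> bq pb; have -> : \sum_(p <= k < b) d k.-1 = \sum_(p.-1 <= k < b.-1) d k.
    by rewrite -{1}(prednK p0) -{1}(prednK (leq_trans p0 pb)) big_add1.
  by apply: sumE => //; apply: leq_trans bq; exact: leq_pred.
have xd k : (p <= k < q)%N -> enorm (x_ k.+1 - x_ k) <= d k + d k.-1 + 2 * ell * l.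
  by move=> kpq; apply: le_trans (xm _ kpq) _; have := md k; have := md k.-1; lra.
have E0 : 0 <= E by apply: le_trans dE; rewrite sumr_ge0.
(* The iterates barely move in the window, so [X0] may replace [x_ k.+1] in the monotonicity
   inequality. *)
have xdist k : (p <= k <= q)%N -> enorm (x_ k - X0) <= e0 + 2 * E + 2 * ell * L.
  move=> /andP[pk kq].
  have : enorm (x_ k - x_ p) <= \sum_(p <= j < k) (d j + d j.-1 + 2 * ell * l).
    elim: k pk kq => [|k IH] pk kq.
      by move: pk; rewrite leqn0 => /eqP->; rewrite subrr enorm0 big_geq.
    have [pk'|] := leqP p k; last first.
      move=> kp; have -> : p = k.+1 by apply/eqP; rewrite eqn_leq pk.
      by rewrite subrr enorm0 big_geq.
    rewrite big_nat_recr//=.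
    have := IH pk' (ltnW kq); have := xd k; rewrite pk' kq => /(_ isT).
    have := enorm_distD (x_ k) (x_ k.+1) (x_ p); lra.
  rewrite !big_split/= sumr_const_nat -mulr_natr.
  have := sumE p k (leq_pred p) kq; have := sumE1 k kq pk.
  have : 2 * ell * l * (k - p)%:R <= 2 * ell * L.
    rewrite LE -!mulrA ler_pM2l// ler_wpM2l// mulrC ler_pM2r// ler_nat.
    by rewrite leq_sub2r.
  have := enorm_distD (x_ p) (x_ k) X0; lra.
pose X := X0 - xi; set e1 := e0 + 2 * E + 2 * ell * L.
have e1_ge0 : 0 <= e1 by apply: le_trans (xdist p _); rewrite ?enorm_ge0// leqnn.
(* One bound for both kinds of cells: the first two terms serve a good cell, the last a bad one, and
   all are nonnegative. *)
pose bnd k := (d k + d k.-1 + 2 * ell * l + l * (enorm eta + e)) * (e + e1) + l * e * enorm X +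
  enorm X * ((1 + 2 * ell + enorm eta) * d k + d k.-1).
have cell k : (p <= k < q)%N -> dotv (x_ k.+1 - x_ k + l *: eta) X <= bnd k.
  move=> kpq; have /andP[pk kq] := kpq; have xk := xd _ kpq.
  have [mk|mk] := leP (m k) ((ell + 1) * l).
    have [xi' [eta' [xi'P eta'P mono]]] := good _ kpq mk.
    set V := x_ k.+1 - x_ k + l *: eta' in mono *.
    have -> : dotv (x_ k.+1 - x_ k + l *: eta) X =
        dotv V (x_ k.+1 - xi') + dotv V ((xi' - xi) - (x_ k.+1 - X0)) - l * dotv (eta' - eta) X.
      rewrite -dotvDr -dotvZl -dotvNl.
      have -> : x_ k.+1 - xi' + (xi' - xi - (x_ k.+1 - X0)) = X.
        by rewrite /X; apply/rowP => i; rewrite !mxE; ring.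
      rewrite -dotvDl; congr dotv; rewrite /V.
      by apply/rowP => i; rewrite !mxE; ring.
    have V1 : enorm V <= d k + d k.-1 + 2 * ell * l + l * (enorm eta + e).
      apply: le_trans (enormD _ _) _; rewrite lerD// enormZ gtr0_norm// ler_pM2l//.
      by apply: le_trans (enorm_subD _ eta) _; rewrite addrC lerD2l.
    have V2 : enorm (xi' - xi - (x_ k.+1 - X0)) <= e + e1.
      apply: le_trans (enormD _ _) _; rewrite enormN lerD//.
      by apply: xdist; rewrite kq (leq_trans pk).
    have h1 : dotv V (xi' - xi - (x_ k.+1 - X0)) <=
        (d k + d k.-1 + 2 * ell * l + l * (enorm eta + e)) * (e + e1).
      apply: le_trans (cauchy_schwarz _ _) _.
      by apply: ler_pM => //; exact: enorm_ge0.
    have h2 : - (l * dotv (eta' - eta) X) <= l * e * enorm X.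
      rewrite -mulrN -mulrA ler_pM2l// -dotvNl.
      apply: le_trans (cauchy_schwarz _ _) _; rewrite enormN.
      by rewrite ler_wpM2r ?enorm_ge0.
    have h3 : 0 <= enorm X * ((1 + 2 * ell + enorm eta) * d k + d k.-1).
      by rewrite mulr_ge0 ?enorm_ge0// addr_ge0// mulr_ge0// !addr_ge0 ?enorm_ge0// mulr_ge0.
    rewrite /bnd; lra.
  have dl : l <= d k by have := ler_norm (m k - ell * l); rewrite -/(d k); lra.
  have h1 : enorm (x_ k.+1 - x_ k + l *: eta) <= (1 + 2 * ell + enorm eta) * d k + d k.-1.
    apply: le_trans (enormD _ _) _; rewrite enormZ gtr0_norm//.
    have : 2 * ell * l <= 2 * ell * d k by rewrite ler_wpM2l// mulr_ge0.
    have : l * enorm eta <= d k * enorm eta by rewrite ler_wpM2r ?enorm_ge0.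
    lra.
  have h2 : dotv (x_ k.+1 - x_ k + l *: eta) X <=
      enorm X * ((1 + 2 * ell + enorm eta) * d k + d k.-1).
    apply: le_trans (cauchy_schwarz _ _) _; rewrite mulrC.
    by rewrite ler_wpM2l ?enorm_ge0.
  have h3 : 0 <= (d k + d k.-1 + 2 * ell * l + l * (enorm eta + e)) * (e + e1).
    apply: mulr_ge0; last exact: addr_ge0.
    by rewrite !addr_ge0// mulr_ge0 ?addr_ge0 ?enorm_ge0 ?mulr_ge0// ltW.
  have h4 : 0 <= l * e * enorm X by rewrite !mulr_ge0 ?enorm_ge0// ltW.
  rewrite /bnd; lra.
have Lsum c : L * c = \sum_(p <= k < q) l * c.
  by rewrite sumr_const_nat -[RHS]mulr_natl LE mulrA.
have -> : dotv (x_ q - x_ p + L *: eta) X = \sum_(p <= k < q) dotv (x_ k.+1 - x_ k + l *: eta) X.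
  rewrite -(telescope_sumr x_ pq) dotvDl dotvZl Lsum.
  rewrite (big_morph (fun v => dotv v X) (fun u v => dotvDl u v X) (dot0v X)).
  by rewrite -big_split/=; apply: eq_bigr => k _; rewrite [RHS]dotvDl dotvZl.
apply: (@le_trans _ _ (\sum_(p <= k < q) bnd k)).
  by rewrite !big_nat; apply: ler_sum => k; exact: cell.
have S0 : \sum_(p <= k < q) d k <= E by exact: sumE (leq_pred p) _.
have S1 : \sum_(p <= k < q) d k.-1 <= E by exact: sumE1.
have -> : \sum_(p <= k < q) bnd k = ((\sum_(p <= k < q) d k) + (\sum_(p <= k < q) d k.-1) +
    2 * ell * L + L * (enorm eta + e)) * (e + e1) + L * e * enorm X +
    enorm X * ((1 + 2 * ell + enorm eta) * (\sum_(p <= k < q) d k) + (\sum_(p <= k < q) d k.-1)).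
  pose A := (e + e1) + enorm X * (1 + 2 * ell + enorm eta).
  pose B := (e + e1) + enorm X.
  pose C := (2 * ell + enorm eta + e) * (e + e1) + e * enorm X.
  have bndE k : bnd k = A * d k + B * d k.-1 + l * C by rewrite /bnd /A /B /C; ring.
  rewrite (eq_bigr _ (fun k _ => bndE k)) big_split/= big_split/= -Lsum -!mulr_sumr.
  by rewrite /A /B /C; ring.
move: S0 S1; set s0 := \sum_(_ <= k < _) d k; set s1 := \sum_(_ <= k < _) d _ => S0 S1.
have : (s0 + s1 + 2 * ell * L + L * (enorm eta + e)) * (e + e1) <=
    (2 * E + 2 * ell * L + L * (enorm eta + e)) * (e + e1).
  by apply: ler_wpM2r; [exact: addr_ge0|rewrite !lerD2r; lra].
have : enorm X * ((1 + 2 * ell + enorm eta) * s0 + s1) <= enorm X * ((2 + 2 * ell + enorm eta) * E).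
  rewrite ler_wpM2l ?enorm_ge0//.
  have : (1 + 2 * ell + enorm eta) * s0 <= (1 + 2 * ell + enorm eta) * E.
    by rewrite ler_wpM2l// !addr_ge0 ?enorm_ge0// mulr_ge0.
  lra.
rewrite -/X; lra.
Qed.

End Window.

Section UltraLimit.
Context {R : realType} {n : nat}.

(** A cluster point of an ultrafilter is a limit. The same [U] serves every time [t], so no
    subsequence is extracted. *)
Lemma bounded_ultra_cvg (U : set_system nat) (f : nat -> 'rV[R]_n) (M : R) :
  UltraFilter U -> (forall j, enorm (f j) <= M) -> exists p : 'rV[R]_n, f @ U --> p.
Proof.
move=> UU fM.
have [|p [_ pc]] := @enorm_ball_compact R n M (f @ U) (fmap_proper_filter _ _).
  by apply: (@filterS _ U _ setT) filterT => j _; exact: fM.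
exists p => B nB; have [//|nfB] := in_ultra_setVsetC (f @^-1` B) UU.
by have [y []] := pc (~` B) B nfB nB.
Qed.

End UltraLimit.

(** * The limit curve and its velocity *)

Section Limit.
Context {R : realType} {n : nat}.
Local Notation vec := 'rV[R]_n.
Notation mu := (@lebesgue_measure R).
Variables (T : R) (F : R -> vec -> set vec).
Hypothesis T0 : 0 < T.
Hypothesis MF : forall t : R, 0 <= t <= T -> maximal_monotone (F t).
Hypothesis F_osc : forall t : R, 0 <= t <= T -> graph_osc_at F T t.
Variables (x0 : vec) (M : R) (g : R -> R).
Hypothesis g0 : forall x, 0 <= g x.
Hypothesis ig : mu.-integrable setT (EFin \o g).
Variables (tt : nat -> nat -> R) (xx : nat -> nat -> vec).
Hypothesis schemeP : forall j,
  is_scheme T F x0 M (primitive g) j.+1 (tt j) (xx j).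

Local Notation P := (primitive g).
Local Notation grd j k := (grid T j.+1 k).

Definition cell_index (j : nat) (t : R) : nat := Num.truncn (t / (T / j.+1%:R)).

Let mesh_gt0 j : 0 < T / j.+1%:R. Proof. by rewrite divr_gt0// ltr0n. Qed.

Lemma cell_index_itv j t : 0 <= t ->
  grd j (cell_index j t) <= t < grd j (cell_index j t) + T / j.+1%:R.
Proof.
move=> t0; rewrite -gridS /grid -ler_pdivlMr// -ltr_pdivrMr//.
by apply: truncn_itv; rewrite divr_ge0// ltW.
Qed.

Lemma cell_index_le j t : 0 <= t <= T -> (cell_index j t <= j.+1)%N.
Proof.
move=> /andP[t0 tT]; have /andP[h _] := cell_index_itv j t t0.
have := le_trans h tT; rewrite /grid mulrCA ger_pMr// ler_pdivrMr ?ltr0n//.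
by rewrite mul1r ler_nat.
Qed.

Lemma cell_index_homo j s t : s <= t -> (cell_index j s <= cell_index j t)%N.
Proof. by move=> st; apply: le_truncn; rewrite ler_pM2r// invr_gt0. Qed.

Let Pnd : {homo P : s t / s <= t}. Proof. exact: primitive_nd. Qed.

Let grd_ge0 j k : 0 <= grd j k. Proof. exact: grid_ge0. Qed.

Let grd_homo j : {homo (grid T j.+1) : i k / (i <= k)%N >-> i <= k}.
Proof. exact: grid_homo. Qed.

Let grd_pred j k : grd j k <= grd j k.-1 + T / j.+1%:R.
Proof. by case: k => [|k]; rewrite ?gridS ?lexx// lerDl ltW. Qed.

(** Bounds that each span two cells telescope along two interleaved chains. *)
Lemma scheme_increment j p q : (p <= q)%N -> (q <= j.+1)%N ->
  enorm (xx j q - xx j p) <= P (grd j q) + P (grd j q.-1) - P (grd j p) - P (grd j p.-1).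
Proof.
move=> + qj; elim: q qj => [|q IH] qj.
  by rewrite leqn0 => /eqP ->; rewrite subrr enorm0; lra.
rewrite leq_eqVlt => /predU1P[->|]; first by rewrite subrr enorm0; lra.
rewrite ltnS => pq; have := IH (ltnW qj) pq.
have [_ _ /(_ q qj)[_ _ _]] := schemeP j.
have := enorm_distD (xx j q) (xx j q.+1) (xx j p); rewrite /=; lra.
Qed.

Variables (U : set_system nat) (UU : UltraFilter U).
Hypothesis oU : \oo `<=` U.
Variable x : R -> vec.
Hypothesis xP : forall t, 0 <= t <= T -> (fun j => xx j (cell_index j t)) @ U --> x t.

Let mesh_small (e : R) : 0 < e -> \forall j \near U, T / j.+1%:R < e.
Proof.
move=> e0; apply: oU; exists (Num.truncn (T / e)) => // j /= h.
rewrite ltr_pdivrMr ?ltr0n// mulrC -ltr_pdivrMr//.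
by apply: lt_le_trans (truncnS_gt _) _; rewrite ler_nat ltnS.
Qed.

Let xP_near t e : 0 <= t <= T -> 0 < e ->
  \forall j \near U, enorm (xx j (cell_index j t) - x t) < e.
Proof. by move=> /xP/cvg_enorm; exact. Qed.

Lemma limit_init : x 0 = x0.
Proof.
have T00 : 0 <= (0 : R) <= T by rewrite lexx ltW.
apply/eqP; rewrite -subr_eq0; apply/eqP/enorm_eq0/eqP.
rewrite eq_le enorm_ge0 andbT; apply/ler_addgt0Pr => e e0; rewrite add0r.
have /filter_ex[j] := xP_near 0 e T00 e0.
have [<- _ _] := schemeP j.
by rewrite /cell_index mul0r truncn0 enormB => /ltW.
Qed.

Lemma limit_increment s t : 0 <= s -> s <= t -> t <= T ->
  enorm (x t - x s) <= 2 * (P t - P s).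
Proof.
move=> s0 st tT.
have sT : 0 <= s <= T by rewrite s0 (le_trans st).
have tT' : 0 <= t <= T by rewrite tT (le_trans s0).
apply/ler_addgt0Pr => e e0.
have e40 : 0 < e / 4 by rewrite divr_gt0.
have [d d0 dP] := abs_cont_interval _ _ _ _ (primitive_ac _ 0 T ig g0) _ e40.
have d20 : 0 < d / 2 by rewrite divr_gt0.
have /filter_ex[j [js jt jd]] : \forall j \near U, [/\
    enorm (xx j (cell_index j s) - x s) < e / 4,
    enorm (xx j (cell_index j t) - x t) < e / 4 & T / j.+1%:R < d / 2].
  near=> j; split; near: j; [exact: xP_near|exact: xP_near|exact: mesh_small].
have := scheme_increment j _ _ (cell_index_homo j s t st) (cell_index_le j t tT').
have /andP[ps1 ps2] := cell_index_itv j s s0.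
have /andP[pt1 pt2] := cell_index_itv j t (le_trans s0 st).
set p := cell_index j s in js ps1 ps2 *; set q := cell_index j t in jt pt1 pt2 *.
have h1 := Pnd _ _ pt1.
have h2 : P (grd j q.-1) <= P t.
  by apply: Pnd; apply: le_trans pt1; apply: grd_homo; exact: leq_pred.
have pp : grd j p.-1 <= grd j p by apply: grd_homo; exact: leq_pred.
(* Among the boundary terms only those at [p] have the wrong sign; [s] is within two meshes of
   [grd j p.-1], hence the mesh below [d / 2]. *)
have h3 : P s - P (grd j p.-1) < e / 4.
  apply: le_lt_trans (ler_norm _) _; apply: dP => //.
  - exact: le_trans ps1.
  - exact: le_trans st tT.
  - move: ps2 jd (grd_pred j p); move: (T / j.+1%:R) => l; lra.
have h4 := Pnd _ _ pp.
have := enorm_distD (xx j q) (x t) (x s); have := enorm_distD (xx j p) (xx j q) (x s).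
rewrite (enormB (x t) (xx j q)); lra.
Unshelve. all: by end_near. Qed.

Lemma limit_velocity t : 0 < t < T ->
  (forall e : R, 0 < e -> exists2 d0 : R, 0 < d0 &
    forall (d : R) (s : nat -> R) p q, 0 < d < d0 -> {homo s : i j / (i <= j)%N >-> i <= j} ->
      (p <= q)%N -> t - d <= s p -> s q <= t + d ->
      \sum_(p <= k < q) `|P (s k.+1) - P (s k) - g t * (s k.+1 - s k)| <= e * d) ->
  derivable x t 1 -> F t (x t) (- (derive1 x t)).
Proof.
move=> /andP[t0 tT] strong dx; have tI : 0 <= t <= T by rewrite !ltW.
apply: maximal_monotone_in; first exact: MF.
move=> xi eta Fxi.
set X := x t - xi; pose v := derive1 x t; pose ell := g t.
have ell0 : 0 <= ell by exact: g0.
(* [K] collects the factors of [e] in [B / h], for [e <= 1] and [h <= e]; the last [enorm X] pays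
   for replacing x(t + h) - x(t) by [h *: v]. *)
pose K := (2 + 4 * ell + 2 * enorm eta + 6) * (6 + 4 * ell) + 2 * enorm X +
  2 * enorm X * (2 + 2 * ell + enorm eta) + enorm X.
rewrite dotvC; suff : dotv (v + eta) X <= 0.
  by rewrite dotvC -oppr_ge0 -dotvNr opprD.
apply: (@le_of_small _ _ _ K) => e /andP[e0 e1]; rewrite add0r.
have [d0 d00 d0P] := strong _ e0.
(* On a good cell l |u| <= m k <= (ell + 1) l, so [ell + 1] bounds the reference velocity, as [M]
   bounds the reference point. *)
have [d1 d10 d1P] := graph_inner_semicontinuous F T t (Num.max M (ell + 1)) xi eta
  MF tI (F_osc _ tI) Fxi e e0.
have [d2 d20 d2P] : exists2 d2 : R, 0 < d2 & forall h, 0 < h < d2 ->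
    enorm (x (t + h) - x t - h *: v) <= e * h.
  have [d2 d20 d2P] := derivable_enorm _ _ _ dx e0.
  exists d2 => // h /andP[h0 hd2]; rewrite -{3}(gtr0_norm h0).
  by apply: d2P; rewrite gtr0_norm.
(* The Lebesgue-point estimate is applied at radius [2 * h], to include the cell before the window;
   [h <= e] makes the displacement term [ell * h] of order [e]. *)
pose h := Num.min (Num.min (d0 / 4) (d1 / 4)) (Num.min (Num.min (d2 / 2) e) ((T - t) / 2)).
have h0 : 0 < h by rewrite !lt_min e0 !divr_gt0// subr_gt0.
have hd0 : h <= d0 / 4 by rewrite /h !ge_min lexx.
have hd1 : h <= d1 / 4 by rewrite /h !ge_min lexx !orbT.
have hd2 : h <= d2 / 2 by rewrite /h !ge_min lexx !orbT.
have he : h <= e by rewrite /h !ge_min lexx !orbT.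
have hT : t + h <= T.
  have : h <= (T - t) / 2 by rewrite /h !ge_min lexx !orbT.
  move: tT; lra.
have thI : 0 <= t + h <= T by rewrite hT andbT addr_ge0// ltW.
pose B := (2 * (e * (2 * h)) + 2 * ell * (2 * h) + (2 * h) * (enorm eta + e)) *
    (e + (e + 2 * (e * (2 * h)) + 2 * ell * (2 * h))) +
    (2 * h) * e * enorm X + enorm X * (2 + 2 * ell + enorm eta) * (e * (2 * h)).
have main : dotv (x (t + h) - x t + h *: eta) X <= B.
  apply/ler_addgt0Pr => k k0.
  (* Three errors of size [k / C] are paid: one at each endpoint, and the difference between [h] and
     the length of the discrete window, times [eta]. *)
  pose C := (2 + enorm eta) * enorm X + 1.
  have C0 : 0 < C by rewrite ltr_wpDl// mulr_ge0 ?addr_ge0 ?enorm_ge0.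
  have kC : 0 < k / C by rewrite divr_gt0.
  have e2 : 0 < Num.min e (k / C) by rewrite lt_min e0.
  have /filter_ex[j [jt jh jm jk]] : \forall j \near U, [/\
      enorm (xx j (cell_index j t) - x t) < Num.min e (k / C),
      enorm (xx j (cell_index j (t + h)) - x (t + h)) < k / C,
      T / j.+1%:R < Num.min (h / 2) (t / 2) & T / j.+1%:R < k / C].
    near=> j; split; near: j; [exact: xP_near|exact: xP_near|
      apply: mesh_small|exact: mesh_small].
    by rewrite lt_min !divr_gt0.
  move: jt jm; rewrite !lt_min => /andP[jt1 jt2] /andP[jm1 jm2].
  have [_ _ sP] := schemeP j; rewrite /= in sP.
  have /andP[pt1 pt2] := cell_index_itv j t (ltW t0).
  have /andP[qt1 qt2] := cell_index_itv j (t + h) (ltW (addr_gt0 t0 h0)).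
  have qj := cell_index_le j _ thI.
  have pq : (cell_index j t <= cell_index j (t + h))%N.
    by apply: cell_index_homo; rewrite lerDl ltW.
  move: jt1 jt2 jh pt1 pt2 qt1 qt2 qj pq.
  set p := cell_index j t; set q := cell_index j (t + h); set l := T / j.+1%:R in jm1 jm2 jk *.
  move=> jt1 jt2 jh pt1 pt2 qt1 qt2 qj pq.
  (* The mesh is below [t / 2], so [t] is not in the first cell and [p.-1] is a genuine
     predecessor. *)
  have p0 : (0 < p)%N.
    by rewrite lt0n; apply/eqP => p0; move: pt2; rewrite p0 /grid mul0r; lra.
  have LE : grd j q - grd j p = (q - p)%:R * l.
    by rewrite /grid -mulrBl natrB.
  pose m k := P (grd j k.+1) - P (grd j k).
  have est : dotv (xx j q - xx j p + (grd j q - grd j p) *: eta) X <=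
     (2 * (e * (2 * h)) + 2 * ell * (grd j q - grd j p) + (grd j q - grd j p) * (enorm eta + e)) *
     (e + (e + 2 * (e * (2 * h)) + 2 * ell * (grd j q - grd j p))) +
     (grd j q - grd j p) * e * enorm X + enorm X * (2 + 2 * ell + enorm eta) * (e * (2 * h)).
    apply: (window_estimate l ell e e _ _ m) => //.
    - exact: mesh_gt0.
    - exact: ltW.
    - by move=> i; rewrite /m subr_ge0; apply: Pnd; exact: grd_homo.
    - move=> i /andP[pi iq]; have [_ _ _] := sP i (leq_trans iq qj).
      by rewrite /m prednK ?(leq_trans p0)//; lra.
    - apply: le_trans (d0P (2 * h) (grid T j.+1) p.-1 q _ _ _ _ _).
      + rewrite le_eqVlt; apply/orP; left; apply/eqP; apply: eq_bigr => i _.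
        by rewrite (_ : grd j i.+1 - grd j i = l)// gridS addrC addKr.
      + by apply/andP; split; lra.
      + exact: grd_homo.
      + exact: leq_trans (leq_pred p) pq.
      + have := grd_pred j p; rewrite -/l; lra.
      + lra.
    - move=> i /andP[pi iq] mi.
      have [/andP[ti1 ti2] Fx [pp [u [Fpu ppM lu]]] _] := sP i (leq_trans iq qj).
      have h1 := grd_homo j _ _ pi; have h2 := grd_homo j _ _ iq.
      have tiI : 0 <= tt j i <= T.
        apply/andP; split; first exact: le_trans (grd_ge0 _ _) ti1.
        by apply: le_trans ti2 _; apply: le_trans h2 _; lra.
      have [|||xi' [eta' [Fxe xx' ee']]] := d1P (tt j i) tiI _ pp u Fpu.
      + by rewrite ltr_norml; apply/andP; split; lra.
      + by rewrite le_max ppM.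
      + rewrite le_max; apply/orP; right; rewrite -(ler_pM2l (mesh_gt0 j)).
        by apply: le_trans lu _; rewrite [leRHS]mulrC; exact: mi.
      exists xi', eta'; split; [exact: ltW|exact: ltW|].
      have [mF _] := MF _ tiI; have := mF _ _ _ _ Fx Fxe.
      rewrite -(pmulr_rge0 _ (mesh_gt0 j)) -dotvZl scalerBr scalerA mulfV ?gt_eqF// scale1r.
      rewrite -oppr_le0 -dotvNl; congr (dotv _ _ <= 0).
      by apply/rowP => i'; rewrite !mxE; rewrite /l; ring.
    - exact: ltW.
  have L1 : grd j q - grd j p <= 2 * h by lra.
  have L0 : 0 <= grd j q - grd j p by rewrite subr_ge0; exact: grd_homo.
  move: est L0 L1; have Lh : `|h - (grd j q - grd j p)| < k / C.
    by rewrite ltr_norml; apply/andP; split; lra.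
  move: Lh; set L := grd j q - grd j p => Lh est L0 L1.
  have estB : dotv (xx j q - xx j p + L *: eta) X <= B.
    apply: le_trans est _; rewrite /B.
    have eh : 0 <= e * (2 * h) by rewrite !mulr_ge0// ltW.
    have u1 : 2 * ell * L <= 2 * ell * (2 * h) by rewrite ler_wpM2l// mulr_ge0.
    have u1' : 0 <= 2 * ell * L by rewrite !mulr_ge0.
    have u2 : L * (enorm eta + e) <= 2 * h * (enorm eta + e).
      by rewrite ler_wpM2r// addr_ge0 ?enorm_ge0// ltW.
    have u2' : 0 <= L * (enorm eta + e) by rewrite mulr_ge0// addr_ge0 ?enorm_ge0// ltW.
    have u3 : L * e * enorm X <= 2 * h * e * enorm X.
      by rewrite ler_wpM2r ?enorm_ge0// ler_wpM2r// ltW.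
    move: u1 u1' u2 u2' u3 eh e0 => /=; clear; move=> *.
    rewrite lerD2r; apply: lerD => //; apply: ler_pM; lra.
  have -> : dotv (x (t + h) - x t + h *: eta) X = dotv (xx j q - xx j p + L *: eta) X +
    dotv ((x (t + h) - xx j q) + (xx j p - x t) + (h - L) *: eta) X.
    by rewrite -dotvDl; congr dotv; apply/rowP => i; rewrite !mxE; ring.
  apply: lerD => //; apply: le_trans (cauchy_schwarz _ _) _.
  have : enorm (x (t + h) - xx j q + (xx j p - x t) + (h - L) *: eta) <=
      k / C * (2 + enorm eta).
    apply: le_trans (enormD _ _) _; have := enormD (x (t + h) - xx j q) (xx j p - x t).
    have : enorm ((h - L) *: eta) <= k / C * enorm eta.
      by rewrite enormZ ler_wpM2r ?enorm_ge0// ltW.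
    rewrite (enormB (x (t + h))); lra.
  move=> /(fun h => ler_wpM2r (enorm_ge0 X) h)/le_trans; apply.
  apply: (@le_trans _ _ (k / C * C)); last by rewrite divfK// gt_eqF.
  rewrite -[leLHS]mulrA; apply: ler_wpM2l; first exact: ltW.
  by rewrite /C lerDl.
have hv := d2P h; have {hv}/hv dist : 0 < h < d2 by apply/andP; split; lra.
have h1 : h <= 1 by exact: le_trans he e1.
have BK : B <= h * (e * (K - enorm X)).
  have X_ge0 := enorm_ge0 X; have eta_ge0 := enorm_ge0 eta.
  have eh : e * h <= e by rewrite ger_pMr.
  have lh : ell * h <= ell * e by rewrite ler_wpM2l.
  have q1 : 0 <= e * h by rewrite mulr_ge0 ?ltW.
  have q2 : 0 <= ell * h by apply: mulr_ge0 => //; exact: ltW.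
  have : (4 * e + 4 * ell + 2 * (enorm eta + e)) * (2 * e + 4 * (e * h) + 4 * (ell * h)) <=
      (2 + 4 * ell + 2 * enorm eta + 6) * (e * (6 + 4 * ell)).
    by apply: ler_pM; lra.
  rewrite -(ler_pM2l h0) /B /K; lra.
rewrite -(ler_pM2l h0) -dotvZl.
have -> : h *: (v + eta) = (x (t + h) - x t + h *: eta) - (x (t + h) - x t - h *: v).
  by apply/rowP => i; rewrite !mxE; ring.
rewrite dotvDl.
have : dotv (- (x (t + h) - x t - h *: v)) X <= e * h * enorm X.
  apply: le_trans (cauchy_schwarz _ _) _; rewrite enormN.
  by rewrite ler_wpM2r ?enorm_ge0.
lra.
Unshelve. all: by end_near. Qed.

End Limit.

(** * Differentiability and uniqueness *)

Section Differentiability.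
Context {R : realType}.
Notation mu := (@lebesgue_measure R).

Lemma ae_mono (A B : R -> Prop) : (forall t, A t -> B t) ->
  {ae mu, forall t, A t} -> {ae mu, forall t, B t}.
Proof. by move=> AB; apply: filterS => //; exact: (ae_filter_ringOfSetsType mu). Qed.

Lemma ae_and (A B : R -> Prop) : {ae mu, forall t, A t} -> {ae mu, forall t, B t} ->
  {ae mu, forall t, A t /\ B t}.
Proof. by apply: filterI; exact: (ae_filter_ringOfSetsType mu). Qed.

(** A coordinate of [x] plus [C * primitive g] is nondecreasing and absolutely continuous, hence a
    primitive up to a constant; so the coordinate is a difference of two functions differentiable
    almost everywhere. *)
Lemma primitive_dominated_derivable n (T : R) (g : R -> R) (C : R) (x : R -> 'rV[R]_n) :
  0 < T -> 0 < C -> (forall t, 0 <= g t) -> mu.-integrable setT (EFin \o g) ->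
  (forall s t, 0 <= s -> s <= t -> t <= T ->
     enorm (x t - x s) <= C * (primitive g t - primitive g s)) ->
  {ae mu, forall t, 0 < t < T -> derivable x t 1}.
Proof.
move=> T0 C0 g0 ig xg.
have Fae := ae_filter_ringOfSetsType mu.
have Pac := primitive_ac _ 0 T ig g0.
have xi_ae (i : 'I_n) : {ae mu, forall t, 0 < t < T -> derivable (fun s => x s ord0 i) t 1}.
  pose f s := x s ord0 i + C * primitive g s.
  have xi s t : 0 <= s -> s <= t -> t <= T ->
      `|x t ord0 i - x s ord0 i| <= C * (primitive g t - primitive g s).
    move=> s0 st tT; apply: le_trans (xg _ _ s0 st tT).
    by have := coord_le_enorm (x t - x s) i; rewrite !mxE.
  have fnd : {in `[0, T] &, {homo f : s t / s <= t}}.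
    move=> s t; rewrite !in_itv/= => /andP[s0 _] /andP[_ tT] st; rewrite /f.
    by have := xi _ _ s0 st tT; rewrite ler_norml => /andP[]; lra.
  have fac : abs_cont (fun r : R => `|r|) 0 T f.
    apply: (abs_cont_le _ _ _ _ (2 * C)) Pac; first by rewrite mulr_gt0.
    move=> s t s0 st tT; rewrite (ger0_norm (x := primitive g t - _)); last first.
      by rewrite subr_ge0 primitive_nd.
    have := xi _ _ s0 st tT; rewrite /f !ler_norml => /andP[h1 h2].
    have : 0 <= C * (primitive g t - primitive g s).
      by rewrite mulr_ge0// ?subr_ge0 ?primitive_nd// ltW.
    by move=> h3; apply/andP; split; lra.
  have [h [_ ih fh]] := abs_cont_density _ _ (ltW T0) fnd fac.
  apply: ae_mono (ae_and _ _ (primitive_derivable _ ih) (primitive_derivable _ ig)).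
  move=> t [dh dg] /andP[t0 tT].
  apply: (@near_eq_derivable _ _ _
    (fun s => primitive h s + (f 0 - primitive h 0) - C * primitive g s)).
    near=> s.
    have s0 : 0 < s by near: s; exact: lt_nbhsr.
    have sT : s < T by near: s; exact: lt_nbhsl.
    have := fh _ _ (lexx 0) (ltW s0) (ltW sT).
    by rewrite -primitive_sub ?(ltW s0)// /f; lra.
  apply: derivableB; last exact: derivableZ.
  by apply: derivableD => //; exact: derivable_cst.
apply: ae_mono (filter_forall Fae xi_ae) => t h tT.
by apply/derivable_mxP => i j; rewrite (ord1 i); exact: h.
Unshelve. all: by end_near. Qed.

End Differentiability.

(** * An almost everywhere criterion for nonincrease *)

Section Monotonicity.
Context {R : realType}.
Notation mu := (@lebesgue_measure R).

(* Cousin's argument: [Q s] says that f increases by at most e s on [0, s], up to its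
   variation over disjoint intervals inside an open set W that contains the exceptional
   null set and has measure less than d; [0, t] is exhausted by a supremum. *)
Lemma abs_cont_nonincreasing (T : R) (f : R -> R) :
  abs_cont (fun r : R => `|r|) 0 T f ->
  {ae mu, forall t, 0 <= t <= T -> forall e : R, 0 < e -> exists2 d : R, 0 < d &
     forall u v, 0 <= u -> u <= t -> t <= v -> v <= T -> t - d < u -> v < t + d ->
       f v - f u <= e * (v - u)} ->
  forall t, 0 <= t <= T -> f t <= f 0.
Proof.
move=> acf [A [mA A0 badA]] t /andP[t0 tT].
(* [e * t] is the growth on the good part and one more [e] is the variation inside [W]. *)
rewrite -subr_le0; apply: (@le_of_small _ _ _ (t + 1)) => e /andP[e0 _]; rewrite add0r.
have [d d0 dP] := acf _ e0.
have Aoo : (mu A < +oo)%E by rewrite A0 ltry.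
have [V [oV AV Vd]] := lebesgue_regularity_outer mA Aoo d0.
pose W := V `&` `](-1), (t + 1)[%classic.
have oW : open W by apply: openI => //; exact: interval_open.
have mV : measurable V by exact: open_measurable.
have mW : measurable W by exact: open_measurable.
have Wd : (mu W < d%:E)%E.
  apply: (@le_lt_trans _ _ (mu V)); first by apply: measureIl.
  apply: le_lt_trans Vd.
  have -> : mu V = (mu (V `\` A) + mu (V `&` A))%E by exact: measureDI.
  rewrite -[leRHS]adde0 leeD2l// -A0; exact: measureIr.
have iW : mu.-integrable setT (EFin \o \1_W).
  apply/integrableP; split; first exact/measurable_EFinP.
  under eq_integral do rewrite /= ger0_norm//.
  by rewrite integral_indic// setIT (lt_le_trans Wd)// leey.
have W0 x : 0 <= \1_W x :> R by [].
(* [G] is a length budget: intervals of total length at most the increment of [G] stay admissible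
   for [d]. *)
pose G := primitive \1_W.
have Gd : G t - G 0 < d.
  rewrite /G primitive_sub// -lte_fin /Rintegral fineK; last first.
    exact/integrable_fin_num/integrable_itv.
  rewrite integral_indic//; apply: le_lt_trans Wd; exact: measureIl.
pose Q s := exists (k : nat) (a b : 'I_k -> R),
  [/\ forall i, 0 <= a i /\ a i <= b i /\ b i <= s,
      forall i j, i != j -> b i <= a j \/ b j <= a i,
      \sum_(i < k) (b i - a i) <= G s - G 0 &
      f s - f 0 <= e * s + \sum_(i < k) `|f (b i) - f (a i)|].
have Q0 : Q 0.
  by exists 0%N, (fun=> 0), (fun=> 0); split; rewrite ?big_ord0 ?subrr ?mulr0 ?addr0//; case.
have Q_good s s' : s <= s' -> f s' - f s <= e * (s' - s) -> Q s -> Q s'.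
  move=> ss' fs [k [a [b [ab disj sG sf]]]]; exists k, a, b; split => //.
  - by move=> i; have [? [? ?]] := ab i; do !split => //; exact: le_trans ss'.
  - by apply: le_trans sG _; rewrite lerD2r primitive_nd.
  - lra.
have Q_bad s s' : 0 <= s -> s <= s' -> `]s, s'] `<=` W -> Q s -> Q s'.
  move=> s0 ss' sW [k [a [b [ab disj sG sf]]]].
  pose ext (c : 'I_k -> R) (y : R) (i : 'I_k.+1) := if unlift ord_max i is Some j then c j else y.
  have extl c y (i : 'I_k) : ext c y (widen_ord (leqnSn k) i) = c i.
    rewrite /ext (_ : widen_ord _ i = lift ord_max i) ?liftK//.
    by apply/val_inj; rewrite /= /bump leqNgt ltn_ord.
  have extm c y : ext c y ord_max = y by rewrite /ext unlift_none.
  exists k.+1, (ext a s), (ext b s'); split.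
  - move=> i; rewrite /ext; case: unliftP => [j|] _.
      by have [? [? ?]] := ab j; do !split => //; exact: le_trans ss'.
    by rewrite lexx.
  - move=> i j; rewrite /ext; case: unliftP => [i'|] ->; case: unliftP => [j'|] ->.
    + by rewrite (inj_eq lift_inj); exact: disj.
    + by move=> _; left; have [_ []] := ab i'.
    + by move=> _; right; have [_ []] := ab j'.
    + by rewrite eqxx.
  - rewrite big_ord_recr/= !extm; under eq_bigr do rewrite !extl.
    have -> : s' - s = G s' - G s.
      rewrite /G primitive_sub//.
      transitivity (\int[mu]_(x in `]s, s']) (1 : R)).
        have L : fine (mu `]s, s']%classic) = s' - s.
          rewrite lebesgue_measure_itv/= lte_fin; case: ltP => //= s's.
          have -> : s = s' by apply/eqP; rewrite eq_le ss' s's.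
          by rewrite subrr.
        by rewrite Rintegral_cst// mul1r; exact: esym L.
      by apply: eq_Rintegral => x; rewrite inE => /sW Wx; rewrite indicE mem_set.
    lra.
  - rewrite big_ord_recr/= !extm; under eq_bigr do rewrite !extl.
    have := ler_norm (f s' - f s); have : e * s <= e * s' by rewrite ler_pM2l.
    lra.
pose S := [set s | 0 <= s <= t /\ Q s].
have S0 : S 0 by split => //; rewrite lexx.
have supS : has_sup S by split; [exists 0|exists t => s [/andP[]]].
pose sg := sup S.
have sg0 : 0 <= sg by apply: ub_le_sup => //; case: supS.
have sgt : sg <= t by apply: ge_sup; [exists 0|move=> s [/andP[]]].
have [r r0 rP] : exists2 r : R, 0 < r & forall u v, 0 <= u -> u <= sg -> sg <= v -> v <= t ->
    sg - r < u -> v < sg + r -> Q u -> Q v.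
  have [Asg|Asg] := pselect (A sg).
    have Wsg : W sg by split; [exact: AV|rewrite /= in_itv/=; apply/andP; split; lra].
    have /nbhs_ballP[r /= r0 rW] : nbhs sg W by exact: open_nbhs_nbhs.
    exists r => // u v u0 us sv vt ur vr; apply: Q_bad => //; first exact: le_trans sv.
    move=> z /=; rewrite in_itv/= => /andP[uz zv]; apply: rW.
    by rewrite /ball/= ltr_norml; apply/andP; split; lra.
  have good : 0 <= sg <= T -> forall e : R, 0 < e -> exists2 d : R, 0 < d &
     forall u v, 0 <= u -> u <= sg -> sg <= v -> v <= T -> sg - d < u -> v < sg + d ->
       f v - f u <= e * (v - u).
    by apply: contrapT => nb; apply: Asg; exact: badA.
  have [|r r0 rP] := good _ e e0; first by rewrite sg0 (le_trans sgt).
  exists r => // u v u0 us sv vt ur vr; apply: Q_good; first exact: le_trans sv.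
  by apply: rP => //; exact: le_trans vt tT.
have [u [/andP[u0 ut] Qu] ur] := sup_adherent r0 supS.
have us : u <= sg by apply: ub_le_sup; [case: supS|split => //; rewrite u0].
(* [v] lies beyond the supremum unless it is cut off at [t]; as [Q v] holds, it must equal [t]. *)
pose v := Num.min t (sg + r / 2).
have vt : v <= t by rewrite ge_min lexx.
have sv : sg <= v by rewrite le_min sgt lerDl divr_ge0// ltW.
have vr : v < sg + r by rewrite gt_min; apply/orP; right; lra.
have Qv := rP u v u0 us sv vt ur vr Qu.
have vs : v <= sg by apply: ub_le_sup; [case: supS|split => //; rewrite vt (le_trans sg0)].
have vE : v = t.
  have : ~~ (sg + r / 2 <= sg) by rewrite -ltNge ltrDl divr_gt0.
  by move: vs; rewrite /v; case: (leP t (sg + r / 2)) => // _ ->.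
rewrite vE in Qv; have [k [a [b [ab disj sG sf]]]] := Qv.
have := dP k a b _ disj (le_lt_trans sG Gd).
have h i : 0 <= a i /\ a i <= b i /\ b i <= T.
  by have [? [? ?]] := ab i; do !split => //; exact: le_trans tT.
move=> /(_ h); lra.
Qed.

End Monotonicity.

(** * Uniqueness of solutions *)

Section Uniqueness.
Context {R : realType} {n : nat}.
Local Notation vec := 'rV[R]_n.
Notation mu := (@lebesgue_measure R).

Lemma abs_cont_bounded (T : R) (z : R -> vec) : abs_cont (@enorm R n) 0 T z ->
  exists B, forall t, 0 <= t <= T -> enorm (z t) <= B.
Proof.
move=> acz; have [d d0 dP] := abs_cont_interval _ _ _ _ acz _ ltr01.
have bnd k t : 0 <= t <= T -> t <= k%:R * (d / 2) -> enorm (z t) <= enorm (z 0) + k%:R.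
  elim: k t => [|k IH] t /andP[t0 tT].
    rewrite mul0r => t0'; have -> : t = 0 by apply/eqP; rewrite eq_le t0 t0'.
    by rewrite addr0.
  rewrite -natr1 mulrDl mul1r => tk.
  pose s := Num.max 0 (t - d / 2).
  have st : s <= t by rewrite ge_max t0 gerBl divr_ge0// ltW.
  have s0 : 0 <= s by rewrite le_max lexx.
  have := dP s t s0 st tT; have := enorm_subD (z t) (z s).
  have := IH s; rewrite s0 (le_trans st)// => /(_ isT).
  have sk : s <= k%:R * (d / 2).
    by rewrite ge_max mulr_ge0 ?divr_ge0 ?(ltW d0)//= lerBlDr.
  have ts : t - s < d.
    have : t - d / 2 <= s by rewrite le_max lexx orbT.
    by move: d0; lra.
  move=> /(_ sk) h1 h2 /(_ ts) h3; lra.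
exists (enorm (z 0) + (Num.truncn (T / (d / 2))).+1%:R) => t tI.
apply: bnd => //; have /andP[_ tT] := tI; apply: le_trans tT _.
by rewrite -ler_pdivrMr ?divr_gt0//; apply/ltW/truncnS_gt.
Qed.

Lemma solution_unique (F : R -> vec -> set vec) (T : R) (x0 : vec) (x y : R -> vec) :
  (forall t, 0 <= t <= T -> monotone_op (F t)) ->
  is_solution F T x0 x -> is_solution F T x0 y ->
  forall t, 0 <= t <= T -> y t = x t.
Proof.
move=> mF [acx [x_0 xae]] [acy [y_0 yae]] t tI.
pose z s := y s - x s.
have acz : abs_cont (@enorm R n) 0 T z.
  apply: abs_contD => //; first exact: enormD.
  apply: (abs_cont_le _ _ _ _ 1) acx => // c d _ _ _.
  by rewrite mul1r -opprD enormN.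
have [B zB] := abs_cont_bounded _ _ acz.
pose f s := dotv (z s) (z s).
have acf : abs_cont (fun r : R => `|r|) 0 T f.
  apply: (abs_cont_le _ _ _ _ (2 * (`|B| + 1))) acz.
    by rewrite mulr_gt0// ltr_wpDl.
  move=> c d c0 cd dT; have -> : f d - f c = dotv (z d + z c) (z d - z c).
    by rewrite /f; move: (z c) (z d) => a b; rewrite !dotvE (dotvC a b); ring.
  apply: le_trans (cauchy_schwarz_norm _ _) _; rewrite ler_wpM2r ?enorm_ge0//.
  apply: le_trans (enormD _ _) _.
  have := zB c; rewrite c0 (le_trans cd)// => /(_ isT).
  have := zB d; rewrite dT (le_trans c0)// => /(_ isT).
  have := ler_norm B; lra.
suff ft : f t <= 0.
  apply/eqP; rewrite -subr_eq0; apply/eqP/enorm_eq0/eqP.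
  rewrite eq_le enorm_ge0 andbT; apply: enorm_le => //.
  by rewrite expr0n.
have f0 : f 0 = 0 by rewrite /f /z x_0 y_0 subrr dot0v.
rewrite -f0; apply: (abs_cont_nonincreasing T f acf) => // {t tI}.
apply: ae_mono (ae_and _ _ xae yae) => t [xt yt] tI e e0.
have tI' : `[0, T]%classic t by rewrite /= in_itv.
have [_ [dx Fx]] := xt tI'; have [_ [dy Fy]] := yt tI'.
pose w := derive1 y t - derive1 x t.
have wz : dotv w (z t) <= 0.
  have := mF _ tI _ _ _ _ Fy Fx.
  have -> : - derive1 y t - - derive1 x t = - w by rewrite /w opprB addrC opprK.
  by rewrite dotvNl oppr_ge0.
pose K := enorm (z t) + 1.
have K0 : 0 < K by rewrite ltr_wpDl ?enorm_ge0.
(* Makes the linear remainder [4 * e1 * enorm (z t) * h] at most [e / 2 * h]; the third entry of [d]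
   below leaves the other half for the quadratic term. *)
pose e1 := Num.min 1 (e / (8 * K)).
have e10 : 0 < e1 by rewrite lt_min ltr01 divr_gt0// mulr_gt0.
have e11 : e1 <= 1 by rewrite ge_min lexx.
have e1K : 8 * e1 * enorm (z t) <= e.
  have : e1 <= e / (8 * K) by rewrite ge_min lexx orbT.
  rewrite ler_pdivlMr ?mulr_gt0//; apply: le_trans.
  by rewrite mulrCA -mulrA ler_pM2l// ler_pM2l// lerDl.
have [d1 d10 d1P] := derivable_enorm _ _ _ dx e10.
have [d2 d20 d2P] := derivable_enorm _ _ _ dy e10.
pose C := (enorm w + 2) ^+ 2.
have C0 : 0 < C by rewrite exprn_gt0// ltr_wpDl ?enorm_ge0.
pose d := Num.min (Num.min d1 d2) (e / (2 * C)).
have zapprox h : `|h| < d -> enorm (z (t + h) - z t - h *: w) <= 2 * e1 * `|h|.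
  rewrite !lt_min => /andP[/andP[h1 h2] _].
  have -> : z (t + h) - z t - h *: w = (y (t + h) - y t - h *: derive1 y t) -
      (x (t + h) - x t - h *: derive1 x t).
    by apply/rowP => i; rewrite !mxE; ring.
  apply: le_trans (enormD _ _) _; rewrite enormN.
  by apply: le_trans (lerD (d2P _ h2) (d1P _ h1)) _; rewrite -mulrA mulrDl mul1r.
have fE h : f (t + h) - f t = 2 * h * dotv w (z t) +
    2 * dotv (z (t + h) - z t - h *: w) (z t) + dotv (z (t + h) - z t) (z (t + h) - z t).
  rewrite /f; move: (z t) (z (t + h)) (w) => a b w'.
  by rewrite !dotvE (dotvC a b); ring.
have rho h : `|h| < d -> `|2 * dotv (z (t + h) - z t - h *: w) (z t)| <= e / 2 * `|h|.
  move=> hd; rewrite normrM ger0_norm//.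
  have := cauchy_schwarz_norm (z (t + h) - z t - h *: w) (z t).
  have := ler_wpM2r (enorm_ge0 (z t)) (zapprox h hd).
  have := ler_wpM2r (normr_ge0 h) e1K.
  move: `|dotv _ _| (enorm (_ - _ *: w)) (enorm (z t)) `|h| => a b c h'; clear; lra.
exists d; first by rewrite !lt_min d10 d20 divr_gt0// mulr_gt0.
move=> u v u0 ut tv vT ud vd.
have hv : `|v - t| < d by rewrite ger0_norm; lra.
have hu : `|u - t| < d by rewrite ler0_norm; lra.
have fv : f v - f t <= e * (v - t).
  have E : t + (v - t) = v by rewrite addrC subrK.
  have fvE := fE (v - t); have r1 := rho _ hv; have zv := zapprox _ hv.
  rewrite E in fvE r1 zv.
  rewrite (ger0_norm (x := v - t)) ?subr_ge0// in r1 zv.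
  have r2 := le_trans (ler_norm _) r1.
  have vt0 : 0 <= v - t by rewrite subr_ge0.
  have h2 : 2 * (v - t) * dotv w (z t) <= 0.
    by apply: mulr_ge0_le0 => //; rewrite mulr_ge0.
  have h3 : dotv (z v - z t) (z v - z t) <= e / 2 * (v - t).
    have D1 : enorm (z v - z t) <= (v - t) * (enorm w + 2).
      apply: le_trans (enorm_subD _ ((v - t) *: w)) _.
      rewrite enormZ ger0_norm//.
      have : e1 * (v - t) <= v - t by rewrite ler_piMl.
      move=> h3; apply: le_trans (lerD zv (lexx _)) _.
      by move: h3; move: (v - t) (enorm w) => b c; clear; lra.
    rewrite -enorm_sqr; apply: (@le_trans _ _ (((v - t) * (enorm w + 2)) ^+ 2)).
      by rewrite ler_sqr// ?nnegrE ?enorm_ge0// mulr_ge0// addr_ge0 ?enorm_ge0.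
    rewrite exprMn -/C expr2 -mulrA mulrC ler_wpM2r//.
    have : v - t < e / (2 * C) by move: hv; rewrite ger0_norm// !lt_min => /andP[].
    have C20 : 0 < 2 * C by exact: mulr_gt0.
    rewrite ltr_pdivlMr// => /ltW; move: (v - t) (C) => a b; clear; lra.
  rewrite fvE; move: r2 h2 h3.
  set a := 2 * (v - t) * _; set b := 2 * dotv _ (z t); set c := dotv _ _.
  by move: a b c (v - t) => a b c d'; clear; lra.
(* To the left of [t] the quadratic term has the favourable sign, so only the linear remainder is
   estimated. *)
have fu : f t - f u <= e * (t - u).
  have E : t + (u - t) = u by rewrite addrC subrK.
  have fuE := fE (u - t); have r1 := rho _ hu.
  rewrite E in fuE r1; rewrite (ler0_norm (x := u - t)) ?subr_le0// in r1.
  move: r1; rewrite ler_norml => /andP[r1 _].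
  have h2 : 0 <= 2 * (u - t) * dotv w (z t).
    by apply: mulr_le0 => //; rewrite pmulr_rle0// subr_le0.
  have h3 := dotv_ge0 (z u - z t).
  have h4 : 0 <= e * (t - u) by rewrite mulr_ge0 ?subr_ge0// ltW.
  rewrite -opprB fuE; move: r1 h2 h3 h4; rewrite opprB.
  set a := 2 * (u - t) * _; set b := 2 * dotv _ (z t); set c := dotv _ _.
  by move: a b c => a b c; clear; lra.
move: fv fu; move: (f u) (f t) (f v) => a b c; clear; lra.
Qed.

End Uniqueness.

Lemma ae_neq {R : realType} (a : R) : {ae (@lebesgue_measure R), forall t, t <> a}.
Proof.
exists [set a]; split; [exact: measurable_set1|exact: lebesgue_measure_set1|].
by move=> t /= /contrapT.
Qed.

Theorem theorem11 (R : realType) (n : nat) (T : R)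
  (F : R -> 'rV[R]_n -> set 'rV[R]_n) :
  0 < T ->
  (* (A1) *)
  (forall t, 0 <= t <= T -> maximal_monotone (F t)) ->
  (* (A2) *)
  (exists phi : R -> R,
     {in `[0, T] &, {homo phi : s t / s <= t}} /\
     abs_cont (fun r : R => `|r|) 0 T phi /\
     (forall s t, 0 <= s -> s <= t -> t <= T ->
        forall z, sdom (F s) z -> vdist z (sdom (F t)) <= phi t - phi s)) ->
  (* (A3) *)
  (forall r : R, 0 < r -> exists sigma : R -> R,
     (forall t, 0 <= t <= T -> 0 <= sigma t) /\
     (@lebesgue_measure R).-integrable `[0, T] (EFin \o sigma) /\
     (forall t x, 0 <= t <= T -> enorm x <= r -> sdom (F t) x ->
        enorm (minsec (F t) x) <= sigma t * (1 + enorm x))) ->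
  (* (A4) *)
  (forall tstar, 0 <= tstar <= T -> graph_osc_at F T tstar) ->
  forall x0 : 'rV[R]_n, closure (sdom (F 0)) x0 ->
  exists x : R -> 'rV[R]_n, is_solution F T x0 x /\
    forall y : R -> 'rV[R]_n, is_solution F T x0 y ->
      forall t, 0 <= t <= T -> y t = x t.
Proof.
move=> T0 MF [phi [phi_nd [phi_ac phi_dom]]] growth osc x0 x0_dom.
have [M [g [g0 ig sch]]] := scheme_exists T F T0 MF phi phi_nd phi_ac phi_dom growth x0 x0_dom.
have /choice[tx txP] : forall j, exists tx : (nat -> R) * (nat -> 'rV[R]_n),
    is_scheme T F x0 M (primitive g) j.+1 tx.1 tx.2.
  by move=> j; have [//|t_ [x_ tx]] := sch j.+1; exists (t_, x_).
pose tt j := (tx j).1; pose xx j := (tx j).2.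
have schP j : is_scheme T F x0 M (primitive g) j.+1 (tt j) (xx j) := txP j.
have [U [UU oU]] := ultraFilterLemma (eventually_filter : ProperFilter \oo).
have /choice[x xP] : forall t, exists p : 'rV[R]_n, 0 <= t <= T ->
    (fun j => xx j (cell_index T j t)) @ U --> p.
  move=> t; have [tI|] := pselect (0 <= t <= T); last by exists 0.
  have [|p pP] := bounded_ultra_cvg U (fun j => xx j (cell_index T j t)) M UU.
    by move=> j; have [_ + _] := schP j; apply; exact: cell_index_le.
  by exists p.
have x_inc := limit_increment T F T0 x0 M g g0 ig tt xx schP U UU oU x xP.
exists x; suff sol : is_solution F T x0 x.
  split=> // y ysol; apply: solution_unique sol ysol.
  by move=> t /MF[].
split; [|split].
- apply: (abs_cont_le _ _ _ _ 2 (primitive g)); [by []| |exact: primitive_ac].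
  move=> c d c0 cd dT; apply: le_trans (x_inc _ _ c0 cd dT) _.
  by rewrite ler_pM2l// ler_norm.
- exact: (limit_init T F T0 x0 M g tt xx schP U UU x xP).
have dx := primitive_dominated_derivable n T g 2 x T0 (ltr0Sn _ 1) g0 ig x_inc.
(* The endpoints are discarded because the velocity argument needs room on both sides of [t]. *)
apply: ae_mono (ae_and _ _ (ae_and _ _ (ae_neq 0) (ae_neq T))
  (ae_and _ _ dx (primitive_strong_derivative g ig))).
move=> t [[t0 tT] [dxt st]]; rewrite /= in_itv/= => /andP[ht0 htT].
have tI : 0 < t < T by rewrite !lt_neqAle ht0 htT !andbT; apply/andP; split; apply/eqP => // /esym.
have Fx := limit_velocity T F T0 MF osc x0 M g g0 ig tt xx schP U UU oU x xP t tI st (dxt tI).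
by split; [exists (- derive1 x t)|split => //; exact: dxt].
Qed.
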